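(* Let $g\in L^2(\mathbb{R}^d)$ with $\|g\|_2=1$ and let $\Lambda\subset\mathbb{R}^{2d}$ be a discrete countable set. The following statements are equivalent: (i) The Gabor system $\{g_\lambda\}_{\lambda\in\Lambda}$ is an orthonormal system. (ii) $\sum_{\lambda\in\Lambda}|V_gf(\omega-\lambda)|^2\le 1$ for every $f\in L^2(\mathbb{R}^d)$ with $\|f\|_2=1$ and every $\omega\in\mathbb{R}^{2d}$ (that is, $|V_gf|^2+\Lambda$ is a packing). (iii) $\sum_{\lambda\in\Lambda}|V_gg(\omega-\lambda)|^2\le 1$ for every $\omega\in\mathbb{R}^{2d}$ (that is, $|V_gg|^2+\Lambda$ is a packing). Moreover, the following statements are also equivalent: (iv) The Gabor system $\{g_\lambda\}_{\lambda\in\Lambda}$ is an orthonormal basis of $L^2(\mathbb{R}^d)$. (v) $\sum_{\lambda\in\Lambda}|V_gf(\omega-\lambda)|^2= 1$ for every $f\in L^2(\mathbb{R}^d)$ with $\|f\|_2=1$ and every $\omega\in\mathbb{R}^{2d}$ (that is, $|V_gf|^2+\Lambda$ is a tiling). (vi) $\sum_{\lambda\in\Lambda}|V_gg(\omega-\lambda)|^2= 1$ for every $\omega\in\mathbb{R}^{2d}$ (that is, $|V_gg|^2+\Lambda$ is a tiling).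
   Context: For $g\in L^2(\mathbb{R}^d)$ and $\lambda=(t,\nu)\in\mathbb{R}^d\times\mathbb{R}^d=\mathbb{R}^{2d}$, the time-frequency shift of $g$ is $g_\lambda(x)=g(x-t)e^{2\pi i\langle x,\nu\rangle}$. The Gabor system associated with $g$ and a discrete countable set $\Lambda\subset\mathbb{R}^{2d}$ is $\{g_\lambda\}_{\lambda\in\Lambda}$. The short time Fourier transform of $f\in L^2(\mathbb{R}^d)$ with window $g$ is $V_gf(t,\nu)=\int_{\mathbb{R}^d}f(x)\overline{g(x-t)}e^{-2\pi i\langle x,\nu\rangle}\,dx=\langle f,g_{(t,\nu)}\rangle$, for $(t,\nu)\in\mathbb{R}^{2d}$. *)

(* Defs.v *)
From HB Require Import structures.
From mathcomp Require Import all_boot all_order all_algebra.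
From mathcomp Require Import finmap.
From mathcomp Require Import all_classical all_reals all_analysis.
From mathcomp Require Import complex.

Set Implicit Arguments.
Unset Strict Implicit.
Unset Printing Implicit Defensive.

Import Order.TTheory GRing.Theory Num.Theory.
Import numFieldNormedType.Exports.

Local Open Scope classical_set_scope.
Local Open Scope ring_scope.
Local Open Scope complex_scope.

(* The product sigma-algebra on row vectors, generated by the coordinate maps;
   over R it is the Borel sigma-algebra of R^n. *)

Definition measure_rV_display : measure_display -> measure_display.
Proof. exact. Qed.

Section measurable_rV.
Context {d} {T : measurableType d}.
Variable n : nat.

Let coors : 'I_n -> 'rV[T]_n -> T := fun i x => x ord0 i.

Let rV_set0 : g_sigma_preimage coors set0.
Proof. exact: sigma_algebra0. Qed.

Let rV_setC A : g_sigma_preimage coors A -> g_sigma_preimage coors (~` A).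
Proof. exact: sigma_algebraC. Qed.

Let rV_bigcup (F : (set 'rV[T]_n)^nat) :
  (forall i, g_sigma_preimage coors (F i)) ->
  g_sigma_preimage coors (\bigcup_i (F i)).
Proof. exact: sigma_algebra_bigcup. Qed.

HB.instance Definition _ := @isMeasurable.Build (measure_rV_display d)
  'rV[T]_n (g_sigma_preimage coors) rV_set0 rV_setC rV_bigcup.

End measurable_rV.

Lemma measurable_coord_rV d (T : measurableType d) n (i : 'I_n) :
  measurable_fun [set: 'rV[T]_n] (fun x : 'rV[T]_n => x ord0 i).
Proof.
move=> _ Y mY; rewrite setTI; apply: sub_sigma_algebra => /=.
rewrite -bigcup_seq/=; exists i => /=; first by rewrite mem_index_enum.
by exists Y => //; rewrite setTI.
Qed.

Lemma measurable_fun_rVP d1 d2 (T1 : measurableType d1)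
    (T2 : measurableType d2) n (f : T1 -> 'rV[T2]_n) :
  measurable_fun [set: T1] f <->
  forall i, measurable_fun [set: T1] (fun x => f x ord0 i).
Proof.
split=> [mf i|mf].
  exact: (measurableT_comp (@measurable_coord_rV _ T2 n i) mf).
move=> _ B mB; rewrite setTI.
suff : (measurable : set (set 'rV[T2]_n)) `<=`
    [set B | measurable (f @^-1` B)] by exact.
apply: smallest_sub.
  split => /=; first by rewrite preimage_set0.
  - by move=> A mA; rewrite setTD; apply: measurableC.
  - by move=> F mF; rewrite preimage_bigcup; exact: bigcup_measurable.
rewrite -bigcup_seq; apply: bigcup_sub => i _ _ [C mC <-] /=.
rewrite setTI -[X in measurable X]setTI; exact: (mf i measurableT C mC).
Qed.

Lemma product_measure1_sigma_finite d1 d2 (T1 : measurableType d1)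
    (T2 : measurableType d2) (R : realType)
    (m1 : {sigma_finite_measure set T1 -> \bar R})
    (m2 : {sigma_finite_measure set T2 -> \bar R}) :
  sigma_finite setT (m1 \x m2)%E.
Proof.
have /sigma_finiteP[F [TF ndF Foo]] := sigma_finiteT m1.
have /sigma_finiteP[G [TG ndG Goo]] := sigma_finiteT m2.
exists (fun n => F n `*` G n).
  rewrite -setXTT TF TG predeqE => -[x y]; split.
    move=> [/= [n _ Fnx] [k _ Gky]]; exists (maxn n k) => //; split.
    - by move: x Fnx; exact/subsetPset/ndF/leq_maxl.
    - by move: y Gky; exact/subsetPset/ndG/leq_maxr.
  by move=> [n _ []/= ? ?]; split; exists n.
move=> k; have [? ?] := Foo k; have [? ?] := Goo k.
split; first exact: measurableX.
by rewrite product_measure1E// lte_mul_pinfty// ge0_fin_numE.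
Qed.

Section lebesgue_rV.
Context {R : realType}.

Section successor.
Variable n : nat.
Variable mu : {sigma_finite_measure set 'rV[R]_n -> \bar R}.

Definition cons_rV (p : R * 'rV[R]_n) : 'rV[R]_n.+1 :=
  row_mx (const_mx p.1 : 'rV_1) p.2.

Lemma cons_rV0 p : cons_rV p ord0 ord0 = p.1.
Proof.
have -> : (ord0 : 'I_n.+1) = lshift n (ord0 : 'I_1) by exact: val_inj.
by rewrite [LHS](@row_mxEl _ 1 1 n) mxE.
Qed.

Lemma cons_rVS p i : cons_rV p ord0 (lift ord0 i) = p.2 ord0 i.
Proof.
have -> : lift ord0 i = rshift 1 i by exact: val_inj.
exact: (@row_mxEr _ 1 1 n).
Qed.

Lemma measurable_cons_rV : measurable_fun setT cons_rV.
Proof.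
apply/measurable_fun_rVP => i; case: (unliftP ord0 i) => [j|] ->.
- under eq_fun do rewrite cons_rVS.
  exact: (measurableT_comp (@measurable_coord_rV _ R n j) measurable_snd).
- under eq_fun do rewrite cons_rV0.
  exact: measurable_fst.
Qed.

Definition lebesgue_rVS : set 'rV[R]_n.+1 -> \bar R :=
  pushforward (@lebesgue_measure R \x mu)%E cons_rV.

Let lebesgue_rVS0 : lebesgue_rVS set0 = 0%E.
Proof. by rewrite /lebesgue_rVS /pushforward preimage_set0 measure0. Qed.

Let lebesgue_rVS_ge0 A : (0 <= lebesgue_rVS A)%E.
Proof. exact: (measure_ge0 (@lebesgue_measure R \x mu)%E). Qed.

Let lebesgue_rVS_semi_sigma_additive : semi_sigma_additive lebesgue_rVS.
Proof.
exact: (@measure_semi_sigma_additive _ _ _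
  (measure_function_pushforward__canonical__measure_function_Measure
    (@lebesgue_measure R \x mu)%E measurable_cons_rV)).
Qed.

HB.instance Definition _ := isMeasure.Build _ _ _ lebesgue_rVS
  lebesgue_rVS0 lebesgue_rVS_ge0 lebesgue_rVS_semi_sigma_additive.

Let lebesgue_rVS_sigma_finite : sigma_finite setT lebesgue_rVS.
Proof.
have [F TF Foo] :=
  product_measure1_sigma_finite (@lebesgue_measure R) mu.
pose uncons (x : 'rV[R]_n.+1) : R * 'rV[R]_n :=
  (x ord0 ord0, \row_i x ord0 (lift ord0 i)).
have unconsK : cancel uncons cons_rV.
  move=> x; apply/rowP => i; case: (unliftP ord0 i) => [j|] ->.
    by rewrite cons_rVS mxE.
  by rewrite cons_rV0.
have consK : cancel cons_rV uncons.
  move=> [a x]; rewrite /uncons cons_rV0; congr pair.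
  by apply/rowP => i; rewrite mxE cons_rVS.
have muncons : measurable_fun setT uncons.
  apply/measurable_fun_pairP; split; first exact: measurable_coord_rV.
  apply/measurable_fun_rVP => i.
  under eq_fun do rewrite mxE.
  exact: measurable_coord_rV.
exists (fun k => uncons @^-1` F k).
  by rewrite -preimage_bigcup -TF preimage_setT.
move=> k; have [mF Fk] := Foo k; split.
  by rewrite -[X in measurable X]setTI; exact: muncons.
rewrite /lebesgue_rVS /pushforward -comp_preimage.
by rewrite (_ : uncons \o cons_rV = id) //; apply/funext => p; exact: consK.
Qed.

HB.instance Definition _ := Measure_isSigmaFinite.Build _ _ _ lebesgue_rVS
  lebesgue_rVS_sigma_finite.

End successor.

Fixpoint lebesgue_rV n : {sigma_finite_measure set 'rV[R]_n -> \bar R} :=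
  match n with
  | 0 => @dirac _ 'rV[R]_0 0 R
  | m.+1 => lebesgue_rVS (lebesgue_rV m)
  end.

Lemma lebesgue_rV_box n (A : 'I_n -> set R) :
  (forall i, measurable (A i)) ->
  lebesgue_rV n [set x : 'rV[R]_n | forall i, A i (x ord0 i)] =
  (\prod_(i < n) @lebesgue_measure R (A i))%E.
Proof.
elim: n A => [|n IHn] A mA.
  rewrite big_ord0 /= diracE mem_set//= => -[]//.
rewrite big_ord_recl /= /lebesgue_rVS /pushforward.
have mB : measurable
    [set x : 'rV[R]_n | forall i, A (lift ord0 i) (x ord0 i)].
  rewrite (_ : mkset _ = \bigcap_(i in [set: 'I_n])
    ((fun x : 'rV[R]_n => x ord0 i) @^-1` A (lift ord0 i))).
    apply: fin_bigcap_measurable => // i _; rewrite -[X in measurable X]setTI.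
    exact: measurable_coord_rV.
  by apply/seteqP; split=> [x Ax i _|x Ax i]; [exact: Ax|exact: (Ax i I)].
rewrite -IHn; last by move=> i; exact: mA.
rewrite -product_measure1E; [|exact: mA|exact: mB].
congr (product_measure1 _ _ _).
apply/seteqP; split=> [p Ap|p [Ap0 Ap] i] /=.
  split=> [|i] /=; first by rewrite -(cons_rV0 p); exact: Ap.
  by rewrite -(cons_rVS p); exact: Ap.
case: (unliftP ord0 i) => [j|] ->; first by rewrite cons_rVS; exact: Ap.
by rewrite cons_rV0.
Qed.

End lebesgue_rV.

Section time_frequency.
Context {R : realType} {n : nat}.

Local Notation Rn := 'rV[R]_n.
Local Notation mu := (@lebesgue_rV R n).

Implicit Types (f g : Rn -> R[i]).

Definition dot (x y : Rn) : R := \sum_(i < n) x ord0 i * y ord0 i.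

Definition expi (t : R) : R[i] := cos t +i* sin t.

(* Only meant for functions whose real and imaginary parts are integrable. *)
Definition cintegral f : R[i] :=
  (\int[mu]_x complex.Re (f x)) +i* (\int[mu]_x complex.Im (f x)).

Definition cabs (z : R[i]) : R := ComplexField.Normc.normc z.

Definition L2norm f : \bar R := Lnorm mu 2%:E (fun x => (cabs (f x))%:E).

(* L^2(R^n) through representatives: functions are not identified when they
   are equal almost everywhere. *)
Definition L2 f : Prop :=
  [/\ measurable_fun setT (fun x => complex.Re (f x)),
      measurable_fun setT (fun x => complex.Im (f x)) &
      (L2norm f < +oo)%E].

Definition inner f g : R[i] := cintegral (fun x => f x * (g x)^*).

Definition orthonormal_system (I : choiceType) (D : set I)
    (e : I -> Rn -> R[i]) : Prop :=
  (forall i, D i -> L2 (e i)) /\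
  (forall i j, D i -> D j -> inner (e i) (e j) = (i == j)%:R).

Definition dense_span (I : choiceType) (D : set I)
    (e : I -> Rn -> R[i]) : Prop :=
  forall f, L2 f -> forall eps : R, 0 < eps ->
  exists (F : {fset I}) (c : I -> R[i]), [set` F] `<=` D /\
    (L2norm (fun x => f x - \sum_(i <- F) c i * e i x)%R < eps%:E)%E.

Definition orthonormal_basis (I : choiceType) (D : set I)
    (e : I -> Rn -> R[i]) : Prop :=
  orthonormal_system D e /\ dense_span D e.

Definition tfshift g (l : Rn * Rn) (x : Rn) : R[i] :=
  g (x - l.1) * expi (2 * pi * dot x l.2).

Definition stft g f (l : Rn * Rn) : R[i] :=
  cintegral (fun x => f x * (g (x - l.1))^* * expi (- (2 * pi * dot x l.2))).

End time_frequency.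

(* Main.v *)
(** Up to a unimodular factor, the inner product of the time-frequency shifts
    [g_a] and [f_b] is [V_g f] at the difference of [a] and [b].  Hence
    [|V_g f (w - l)| = |<f_{-w}, g_{-l}>|], and [|V_g g|] is even.  In a packing
    by [|V_g g|^2] the term at [w = l] already equals [1], so [V_g g] vanishes at
    all differences of distinct points of [Lambda]; this is orthonormality, and
    Bessel's inequality gives the packing property for every [f].

    In the tiling case, Parseval's identity holds for all shifts [g_w], so the
    closed span [K] of the system contains every [g_w].  Such a [K] is all of
    [L^2].  Indeed, the real functions [m] for which multiplication by [m]
    preserves the [f] all of whose modulations lie in [K] form an algebra that is
    closed under bounded pointwise limits and contains the functions
    [sin (2 pi <x, v>)]; so it contains the indicators of half-spaces, hence all
    bounded measurable functions.  Therefore [K] contains the restriction of any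
    [f] in [L^2] to the support of any translate of [g].  The set of largest
    mass for [|f|^2] among those to which restriction maps [L^2] into [K] then
    contains almost every point of these supports, and by Tonelli's theorem
    its complement carries no mass.

    The tiling condition for [V_g g] is invariant under [Lambda -> - Lambda]
    by evenness, which turns completeness of the system indexed by [Lambda] into
    that of the one indexed by [- Lambda], needed for the tilings by [|V_g f|^2]. *)

Require Import Defs.
From mathcomp Require Import all_boot all_order all_algebra.
From mathcomp Require Import all_classical all_reals all_analysis.
From mathcomp Require Import measurable_realfun finmap complex ring lra.

Set Implicit Arguments.
Unset Strict Implicit.
Unset Printing Implicit Defensive.

Import Order.TTheory GRing.Theory Num.Theory.
Import numFieldNormedType.Exports.

Local Open Scope classical_set_scope.
Local Open Scope ring_scope.

(** * Invariance of Lebesgue measure *)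

(** Translation carries half-open intervals to half-open intervals of the same length, and these
    determine Lebesgue measure. *)
Lemma lebesgue_measure_shift (R : realType) (a : R) (A : set R) :
  measurable A ->
  lebesgue_measure ((fun x => x + a) @^-1` A) = lebesgue_measure A.
Proof.
pose f (x : R) : measurableTypeR R := x + a.
have mf : measurable_fun setT f by exact: measurable_funD.
move=> mA; apply/esym; change (lebesgue_measure A =
  pushforward (@lebesgue_measure R) f A).
apply: lebesgue_measure_unique => //= _ [[x y] _ <-].
rewrite /pushforward /f/=.
rewrite (_ : _ @^-1` _ = `](x - a), (y - a)]%classic); last first.
  by apply/seteqP; split=> z /=; rewrite !in_itv/= ltrBlDr lerBrDr.
by rewrite !lebesgue_measure_itv/= !lte_fin ltrD2r -!EFinD opprB subrKA.
Qed.

Lemma lebesgue_measure_reflect (R : realType) (a : R) (A : set R) :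
  measurable A ->
  lebesgue_measure ((fun x => a - x) @^-1` A) = lebesgue_measure A.
Proof.
move=> mA.
pose B := (fun x : R => x + a) @^-1` A.
have mB : measurable B.
  by rewrite -[B]setTI; apply: measurable_funD => //; exact: measurable_cst.
rewrite -(lebesgue_measure_shift a mA) -/B -(lebesgue_measureN mB).
by congr lebesgue_measure; apply/seteqP; split=> x /=; rewrite /B/= addrC.
Qed.

(** Induction along the recursive construction of [lebesgue_rV]: the image of the product measure
    under the product map [phi] agrees with it on rectangles, hence everywhere by uniqueness of
    product measures. Translations and reflections are both of this coordinatewise form. *)
Lemma lebesgue_rV_coordwise (R : realType) n (T : 'I_n -> R -> R) :
  (forall i, measurable_fun setT (T i)) ->
  (forall i A, measurable A ->
    lebesgue_measure (T i @^-1` A) = lebesgue_measure A) ->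
  forall A : set 'rV[R]_n, measurable A ->
    lebesgue_rV n ((fun x : 'rV[R]_n => \row_i T i (x ord0 i)) @^-1` A) =
    lebesgue_rV n A.
Proof.
elim: n T => [|n IHn] T mT lT A mA.
  congr (lebesgue_rV 0 _); apply/seteqP; split=> x /=;
  by rewrite (_ : \row_i _ = x)//; apply/rowP => -[].
pose T' i := T (lift ord0 i).
pose phi (p : measurableTypeR R * 'rV[R]_n) : measurableTypeR R * 'rV[R]_n :=
  (T ord0 p.1, \row_i T' i (p.2 ord0 i)).
have mphi2 : measurable_fun setT (fun x : 'rV[R]_n => \row_i T' i (x ord0 i)).
  apply/measurable_fun_rVP => i; under eq_fun do rewrite mxE.
  by apply: measurableT_comp; [exact: mT|exact: measurable_coord_rV].
have mphi : measurable_fun setT phi.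
  apply/measurable_fun_pairP; split.
    have mT0 : measurable_fun setT
      (T ord0 : measurableTypeR R -> measurableTypeR R) by exact: mT.
    by apply: (measurableT_comp mT0); exact: measurable_fst.
  exact: (measurableT_comp mphi2 measurable_snd).
rewrite /= /lebesgue_rVS /pushforward.
have mcA : measurable (@cons_rV R n @^-1` A).
  by rewrite -[X in measurable X]setTI; exact: measurable_cons_rV.
pose m' := measure_function_pushforward__canonical__measure_function_Measure
  (@lebesgue_measure R \x lebesgue_rV n)%E mphi.
have m'E : forall X Y, measurable X -> measurable Y ->
    m' (X `*` Y) = (@lebesgue_measure R X * lebesgue_rV n Y)%E.
  move=> X Y mX mY; rewrite /m'/= /pushforward.
  rewrite (_ : _ @^-1` _ = (T ord0 @^-1` X) `*`
      ((fun x : 'rV[R]_n => \row_i T' i (x ord0 i)) @^-1` Y))//.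
  rewrite product_measure1E.
  - rewrite [X in (X * _)%E]lT// IHn// => i *; [exact: mT|exact: lT].
  - by rewrite -[X in measurable X]setTI; exact: mT.
  - by rewrite -[X in measurable X]setTI; exact: mphi2.
rewrite (@product_measure_unique _ _ _ _ _ (@lebesgue_measure R)
  (lebesgue_rV n) m' m'E _ mcA) /m'/= /pushforward.
congr (product_measure1 _ _ _); apply/seteqP; split=> p /=;
suff -> : \row_i T i (cons_rV p ord0 i) = cons_rV (phi p) by [].
  apply/rowP => i; rewrite mxE; case: (unliftP ord0 i) => [j|] ->.
    by rewrite !cons_rVS mxE.
  by rewrite !cons_rV0.
apply/rowP => i; rewrite mxE; case: (unliftP ord0 i) => [j|] ->.
  by rewrite !cons_rVS mxE.
by rewrite !cons_rV0.
Qed.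

Section invariance.
Context {R : realType} {n : nat}.
Implicit Types (a : 'rV[R]_n) (A : set 'rV[R]_n).

Lemma measurable_shift_rV a : measurable_fun setT (fun x : 'rV[R]_n => x + a).
Proof.
apply/measurable_fun_rVP => i; under eq_fun do rewrite mxE.
by apply: measurable_funD => //; exact: measurable_coord_rV.
Qed.

Lemma lebesgue_rV_shift a A : measurable A ->
  lebesgue_rV n ((fun x => x + a) @^-1` A) = lebesgue_rV n A.
Proof.
move=> mA.
rewrite -(@lebesgue_rV_coordwise R n (fun i y => y + a ord0 i) _ _ A mA).
- congr (lebesgue_rV n _); rewrite (_ : (fun x => x + a) = (fun x : 'rV[R]_n =>
    \row_i (x ord0 i + a ord0 i)))//.
  by apply/funext => x; apply/rowP => i; rewrite !mxE.
- by move=> i; exact: measurable_funD.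
- by move=> i B mB; exact: lebesgue_measure_shift.
Qed.

Lemma lebesgue_rV_reflect a A : measurable A ->
  lebesgue_rV n ((fun x => a - x) @^-1` A) = lebesgue_rV n A.
Proof.
move=> mA.
rewrite -(@lebesgue_rV_coordwise R n (fun i y => a ord0 i - y) _ _ A mA).
- congr (lebesgue_rV n _); rewrite (_ : (fun x => a - x) = (fun x : 'rV[R]_n =>
    \row_i (a ord0 i - x ord0 i)))//.
  by apply/funext => x; apply/rowP => i; rewrite !mxE.
- by move=> i; exact: measurable_funB.
- by move=> i B mB; exact: lebesgue_measure_reflect.
Qed.

Lemma ge0_integral_shift_rV a (f : 'rV[R]_n -> \bar R) :
  measurable_fun setT f -> (forall x, (0 <= f x)%E) ->
  (\int[lebesgue_rV n]_x f (x + a)%R = \int[lebesgue_rV n]_x f x)%E.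
Proof.
move=> mf f0.
have mT := measurable_shift_rV a.
transitivity (\int[pushforward (lebesgue_rV n) (fun x : 'rV[R]_n => (x + a)%R)]_x
    f x)%E; first by rewrite ge0_integral_pushforward.
by apply: eq_measure_integral => A mA _; exact: lebesgue_rV_shift.
Qed.

Lemma integral_shift_rV a (f : 'rV[R]_n -> \bar R) : measurable_fun setT f ->
  (\int[lebesgue_rV n]_x f (x + a)%R = \int[lebesgue_rV n]_x f x)%E.
Proof.
move=> mf; rewrite integralE [RHS]integralE.
rewrite -(@ge0_integral_shift_rV a (f^\+)%E)//; last exact: measurable_funepos.
rewrite -(@ge0_integral_shift_rV a (f^\-)%E)//; last exact: measurable_funeneg.
by congr (_ - _)%E; apply: eq_integral => x _; rewrite ?funeposE ?funenegE.

Qed.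

End invariance.

(** * Complex-valued functions *)

Section complex_modulus.
Context {R : realType}.
Implicit Types z w : R[i].

Lemma cabs_sqr z : cabs z ^+ 2 = complex.Re z ^+ 2 + complex.Im z ^+ 2.
Proof. by case: z => a b; rewrite /cabs /= sqr_sqrtr// addr_ge0// sqr_ge0. Qed.

Lemma mulcJ z : z * z^* = (cabs z ^+ 2)%:C%C.
Proof.
rewrite cabs_sqr; case: z => a b; rewrite /conjc /real_complex_def.
by apply/eqP; rewrite eq_complex /=; apply/andP; split; apply/eqP; ring.
Qed.

Lemma cabsM z w : cabs (z * w) = cabs z * cabs w.
Proof. exact: ComplexField.Normc.normcM. Qed.

Lemma cabs_ge0 z : 0 <= cabs z.
Proof. by case: z => a b; exact: sqrtr_ge0. Qed.

Lemma cabs0 : cabs (0 : R[i]) = 0.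
Proof. exact: ComplexField.Normc.normc0. Qed.

Lemma cabs1 : cabs (1 : R[i]) = 1.
Proof. exact: ComplexField.Normc.normc1. Qed.

Lemma cabs_eq0 z : cabs z = 0 -> z = 0.
Proof. exact: ComplexField.Normc.eq0_normc. Qed.

Lemma cabsJ z : cabs z^* = cabs z.
Proof. by case: z => a b; rewrite /cabs /= sqrrN. Qed.

Lemma cabs_expi (t : R) : cabs (expi t) = 1.
Proof. by rewrite /cabs /= cos2Dsin2 sqrtr1. Qed.

Lemma expiD (s t : R) : expi (s + t) = expi s * expi t.
Proof.
by apply/eqP; rewrite eq_complex /= cosD sinD (mulrC (sin s)) [_ + cos s * _]addrC
  (mulrC (sin s)) !eqxx.
Qed.

Lemma expi0 : expi (0 : R) = 1.
Proof. by rewrite /expi cos0 sin0. Qed.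

Lemma expiN (t : R) : expi (- t) = (expi t)^*.
Proof. by rewrite /expi cosN sinN. Qed.

(** By the parallelogram identity the two sides differ by [cabs (z - w) ^+ 2]. *)
Lemma cabs_sqrD z w :
  cabs (z + w) ^+ 2 <= 2 * cabs z ^+ 2 + 2 * cabs w ^+ 2.
Proof.
rewrite !cabs_sqr; case: z w => [a b] [c d] /=.
by have := sqr_ge0 (a - c); have := sqr_ge0 (b - d); nra.
Qed.

(** This bound and the next one dominate both parts of the integrand of [inner f g] by the sum of
    [|f|^2] and [|g|^2], which is integrable for [f] and [g] in [L2]. *)
Lemma normr_Re_mulJ z w :
  `|complex.Re (z * w^*)| <= cabs z ^+ 2 + cabs w ^+ 2.
Proof.
rewrite !cabs_sqr; case: z w => [a b] [c d] /=; rewrite ler_norml.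
have := sqr_ge0 (a - c); have := sqr_ge0 (b - d).
have := sqr_ge0 (a + c); have := sqr_ge0 (b + d).
by move=> *; apply/andP; split; nra.
Qed.

Lemma normr_Im_mulJ z w :
  `|complex.Im (z * w^*)| <= cabs z ^+ 2 + cabs w ^+ 2.
Proof.
rewrite !cabs_sqr; case: z w => [a b] [c d] /=; rewrite ler_norml.
have := sqr_ge0 (a - d); have := sqr_ge0 (b - c).
have := sqr_ge0 (a + d); have := sqr_ge0 (b + c).
by move=> *; apply/andP; split; nra.
Qed.

Lemma ReD z w : complex.Re (z + w) = complex.Re z + complex.Re w.
Proof. by case: z w => [? ?] []. Qed.

Lemma ImD z w : complex.Im (z + w) = complex.Im z + complex.Im w.
Proof. by case: z w => [? ?] []. Qed.

Lemma ReM z w : complex.Re (z * w) =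
  complex.Re z * complex.Re w - complex.Im z * complex.Im w.
Proof. by case: z w => [? ?] []. Qed.

Lemma ImM z w : complex.Im (z * w) =
  complex.Re z * complex.Im w + complex.Im z * complex.Re w.
Proof. by case: z w => [? ?] []. Qed.

Lemma ReJ z : complex.Re z^* = complex.Re z.
Proof. by case: z. Qed.

Lemma ImJ z : complex.Im z^* = - complex.Im z.
Proof. by case: z. Qed.

Lemma conjB z w : (z - w)^* = z^* - w^*.
Proof. exact: rmorphB. Qed.

Lemma conjM z w : (z * w)^* = z^* * w^*.
Proof. exact: rmorphM. Qed.

Lemma conj_sum (I : Type) (s : seq I) (F : I -> R[i]) :
  (\sum_(i <- s) F i)^* = \sum_(i <- s) (F i)^*.
Proof. exact: rmorph_sum. Qed.

End complex_modulus.

Section complex_measurability.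
Context {R : realType} {n : nat}.
Implicit Types f g : 'rV[R]_n -> R[i].

Definition cmeasurable f := measurable_fun setT (fun x => complex.Re (f x)) /\
  measurable_fun setT (fun x => complex.Im (f x)).

Lemma cmeasurable_cst z : cmeasurable (fun=> z).
Proof. by split; exact: measurable_cst. Qed.

Lemma cmeasurableD f g : cmeasurable f -> cmeasurable g ->
  cmeasurable (fun x => f x + g x).
Proof.
move=> [fr fi] [gr gi]; split.
  by under eq_fun do rewrite ReD; exact: measurable_funD.
by under eq_fun do rewrite ImD; exact: measurable_funD.
Qed.

Lemma cmeasurableM f g : cmeasurable f -> cmeasurable g ->
  cmeasurable (fun x => f x * g x).
Proof.
move=> [fr fi] [gr gi]; split.
  by under eq_fun do rewrite ReM; apply: measurable_funB; exact: measurable_funM.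
by under eq_fun do rewrite ImM; apply: measurable_funD; exact: measurable_funM.
Qed.

Lemma cmeasurableJ f : cmeasurable f -> cmeasurable (fun x => (f x)^*).
Proof.
move=> [fr fi]; split; first by under eq_fun do rewrite ReJ.
by under eq_fun do rewrite ImJ; exact: measurable_funN.
Qed.

Lemma cmeasurable_shift f (a : 'rV[R]_n) : cmeasurable f ->
  cmeasurable (fun x => f (x + a)).
Proof.
have ma := measurable_shift_rV a.
by move=> [fr fi]; split; [apply: (measurableT_comp fr)|apply: (measurableT_comp fi)].
Qed.

Lemma measurable_cabs_sqr f : cmeasurable f ->
  measurable_fun setT (fun x => cabs (f x) ^+ 2).
Proof.
move=> [fr fi]; under eq_fun do rewrite cabs_sqr.
by apply: measurable_funD; exact: measurable_funX.
Qed.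

Lemma measurable_dot (v : 'rV[R]_n) : measurable_fun setT (fun x => dot x v).
Proof.
apply: measurable_sum => i; apply: measurable_funM; last exact: measurable_cst.
exact: measurable_coord_rV.
Qed.

Lemma cmeasurable_expi (h : 'rV[R]_n -> R) : measurable_fun setT h ->
  cmeasurable (fun x => expi (h x)).
Proof.
move=> mh; split => /=; apply: measurableT_comp => //;
  apply: continuous_measurable_fun; [exact: continuous_cos|exact: continuous_sin].
Qed.

End complex_measurability.

(** * Complex integrals, the squared norm and the inner product *)

Section complex_integral.
Context {R : realType} {n : nat}.
Local Notation mu := (@lebesgue_rV R n).
Implicit Types f g h : 'rV[R]_n -> R[i].

Definition cintegrable f :=
  mu.-integrable setT (EFin \o (fun x => complex.Re (f x))) /\
  mu.-integrable setT (EFin \o (fun x => complex.Im (f x))).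

Lemma cintegralD f g : cintegrable f -> cintegrable g ->
  cintegral (fun x => f x + g x) = cintegral f + cintegral g.
Proof.
move=> [fr fi] [gr gi]; apply/eqP; rewrite eq_complex /=.
rewrite -!RintegralD//; apply/andP; split; apply/eqP; apply: eq_Rintegral => x _.
  exact: ReD.
exact: ImD.
Qed.

Let integrableZ (r : R) (u : 'rV[R]_n -> R) :
  mu.-integrable setT (EFin \o u) -> mu.-integrable setT (EFin \o (fun x => r * u x)).
Proof. by move=> iu; have := @integrableZl _ _ _ mu _ measurableT r _ iu. Qed.

Lemma cintegralZ z f : cintegrable f ->
  cintegral (fun x => z * f x) = z * cintegral f.
Proof.
move=> [fr fi]; case: z => a b.
rewrite /cintegral; apply/eqP; rewrite eq_complex /=.
rewrite -!RintegralZl// -RintegralB//; [|exact: integrableZ..].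
rewrite -RintegralD//; [|exact: integrableZ..].
apply/andP; split; apply/eqP; apply: eq_Rintegral => x _.
  by case: (f x).
by case: (f x).
Qed.

Lemma cintegralJ f : cintegrable f ->
  cintegral (fun x => (f x)^*) = (cintegral f)^*.
Proof.
move=> [fr fi]; apply/eqP; rewrite eq_complex /=.
rewrite -mulN1r -RintegralZl//.
apply/andP; split; apply/eqP; apply: eq_Rintegral => x _; first by rewrite ReJ.
by rewrite ImJ mulN1r.
Qed.

Lemma eq_cintegral f g : f =1 g -> cintegral f = cintegral g.
Proof. by move=> fg; congr cintegral; exact/funext. Qed.

Lemma cintegral_shift f (a : 'rV[R]_n) : cmeasurable f ->
  cintegral (fun x => f (x + a)) = cintegral f.
Proof.
move=> [fr fi]; rewrite /cintegral /Rintegral.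
by rewrite (@integral_shift_rV _ _ a (fun x => (complex.Re (f x))%:E))
  ?(@integral_shift_rV _ _ a (fun x => (complex.Im (f x))%:E))//;
  exact/measurable_EFinP.
Qed.

(** The square of [L2norm], which keeps square roots out of the quadratic expansions; its values are
    extended reals, so it can be used before square integrability is known. *)
Definition sqnorm f : \bar R := (\int[mu]_x (cabs (f x) ^+ 2)%:E)%E.

Lemma sqnorm_ge0 f : (0 <= sqnorm f)%E.
Proof. by apply: integral_ge0 => x _; rewrite lee_fin sqr_ge0. Qed.

Lemma L2normE f : L2norm f = sqrte (sqnorm f).
Proof.
rewrite -poweR12_sqrt ?sqnorm_ge0// /L2norm unlock; congr (_ `^ _)%E.
apply: eq_integral => x _; rewrite gee0_abs ?lee_fin ?cabs_ge0//.
by rewrite poweR_EFin powR_mulrn ?cabs_ge0.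
Qed.

Lemma L2norm_eq1 f : L2norm f = 1%E <-> sqnorm f = 1%E.
Proof.
rewrite L2normE; have := sqnorm_ge0 f; case: (sqnorm f) => [r| |]//= r0.
split=> -[]; last by move=> ->; rewrite sqrtr1.
move=> s; rewrite -[r]sqr_sqrtr//; last by rewrite s expr1n.
Qed.

Lemma L2norm_lt f (e : R) : 0 < e ->
  (L2norm f < e%:E)%E = (sqnorm f < (e ^+ 2)%:E)%E.
Proof.
move=> e0; rewrite L2normE; have := sqnorm_ge0 f.
case: (sqnorm f) => [r| |]//=; rewrite !lee_fin !lte_fin => r0.
rewrite -[in RHS](sqr_sqrtr r0) ltr_pXn2r// nnegrE ?sqrtr_ge0//.
exact: ltW.
Qed.

Lemma L2P f : L2 f <-> cmeasurable f /\ (sqnorm f < +oo)%E.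
Proof.
have E : (L2norm f < +oo)%E = (sqnorm f < +oo)%E.
  by rewrite L2normE; have := sqnorm_ge0 f; case: (sqnorm f) => [r| |]//=;
     rewrite !ltry.
by rewrite /L2 E; split=> [[]|[[]]].
Qed.

Lemma L2_cmeasurable f : L2 f -> cmeasurable f.
Proof. by case/L2P. Qed.

Lemma L2_integrable_sqr f : L2 f ->
  mu.-integrable setT (EFin \o (fun x => cabs (f x) ^+ 2)).
Proof.
move=> /L2P[mf fy]; apply/integrableP; split.
  by apply/measurable_EFinP; exact: measurable_cabs_sqr.
rewrite (le_lt_trans _ fy)// /sqnorm le_eqVlt; apply/orP; left; apply/eqP.
by apply: eq_integral => x _; rewrite /= ger0_norm// sqr_ge0.
Qed.

Lemma cintegrable_mulJ f g : L2 f -> L2 g ->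
  cintegrable (fun x => f x * (g x)^*).
Proof.
move=> f2 g2.
have [mr mi] := cmeasurableM (L2_cmeasurable f2) (cmeasurableJ (L2_cmeasurable g2)).
have ifg : mu.-integrable setT
    (EFin \o (fun x => cabs (f x) ^+ 2 + cabs (g x) ^+ 2)).
  exact: (integrableD measurableT (L2_integrable_sqr f2) (L2_integrable_sqr g2)).
have bound (u : 'rV[R]_n -> R) : measurable_fun setT u ->
    (forall x, `|u x| <= cabs (f x) ^+ 2 + cabs (g x) ^+ 2) ->
    mu.-integrable setT (EFin \o u).
  move=> um uE; apply: (le_integrable measurableT _ _ ifg).
    exact/measurable_EFinP.
  by move=> x _ /=; rewrite lee_fin [leRHS]ger0_norm// addr_ge0 ?sqr_ge0.
by split; apply: bound => // x; [exact: normr_Re_mulJ|exact: normr_Im_mulJ].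
Qed.

Lemma sqnormE f : L2 f -> inner f f = (fine (sqnorm f))%:C%C.
Proof.
move=> f2; rewrite /inner /cintegral; apply/eqP; rewrite eq_complex /=.
apply/andP; split; apply/eqP.
  by congr fine; apply: eq_integral => x _; rewrite mulcJ.
under eq_Rintegral do rewrite mulcJ /=.
by rewrite Rintegral_cst// mul0r.
Qed.

Lemma sqnorm_fin f : L2 f -> sqnorm f \is a fin_num.
Proof. by move=> /L2P[_ fy]; rewrite ge0_fin_numE// sqnorm_ge0. Qed.

Lemma sqnorm_fineK f : L2 f -> sqnorm f = (fine (sqnorm f))%:E.
Proof. by move=> f2; rewrite fineK// sqnorm_fin. Qed.

(** A substitute for the triangle inequality that stays with squared norms; the factors [2] are
    harmless in approximation arguments. *)
Lemma sqnormD f g : cmeasurable f -> cmeasurable g ->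
  (sqnorm (fun x => (f x + g x)%R) <= 2%:E * sqnorm f + 2%:E * sqnorm g)%E.
Proof.
move=> mf mg; rewrite /sqnorm -!ge0_integralZl ?lee_fin//; last 4 first.
  - by apply/measurable_EFinP; exact: measurable_cabs_sqr.
  - by move=> x _; rewrite lee_fin sqr_ge0.
  - by apply/measurable_EFinP; exact: measurable_cabs_sqr.
  - by move=> x _; rewrite lee_fin sqr_ge0.
rewrite -ge0_integralD//; last 4 first.
  - by move=> x _; rewrite lee_fin mulr_ge0// sqr_ge0.
  - apply/measurable_EFinP; apply: measurable_funM; first exact: measurable_cst.
    exact: measurable_cabs_sqr.
  - by move=> x _; rewrite lee_fin mulr_ge0// sqr_ge0.
  - apply/measurable_EFinP; apply: measurable_funM; first exact: measurable_cst.
    exact: measurable_cabs_sqr.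
apply: ge0_le_integral => //.
- by move=> x _; rewrite lee_fin sqr_ge0.
- by apply/measurable_EFinP; exact: (measurable_cabs_sqr (cmeasurableD mf mg)).
- have m2 h : cmeasurable h -> measurable_fun setT (fun x => 2 * cabs (h x) ^+ 2).
    by move=> mh; apply: measurable_funM => //; exact: measurable_cabs_sqr.
  by apply/measurable_EFinP; apply: measurable_funD; exact: m2.
- by move=> x _; rewrite -EFinD lee_fin cabs_sqrD.
Qed.

Lemma le_sqnorm f g : cmeasurable f -> cmeasurable g ->
  (forall x, cabs (f x) ^+ 2 <= cabs (g x) ^+ 2) -> (sqnorm f <= sqnorm g)%E.
Proof.
move=> mf mg fg; apply: ge0_le_integral => //.
- by move=> x _; rewrite lee_fin sqr_ge0.
- by apply/measurable_EFinP; exact: measurable_cabs_sqr.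
- by apply/measurable_EFinP; exact: measurable_cabs_sqr.
- by move=> x _; rewrite lee_fin.
Qed.

Lemma sqnormZ z f : cmeasurable f ->
  sqnorm (fun x => z * f x) = ((cabs z ^+ 2)%:E * sqnorm f)%E.
Proof.
move=> mf; rewrite /sqnorm -ge0_integralZl//; last 3 first.
  - by apply/measurable_EFinP; exact: measurable_cabs_sqr.
  - by move=> x _; rewrite lee_fin sqr_ge0.
  - by rewrite lee_fin sqr_ge0.
by apply: eq_integral => x _; rewrite cabsM exprMn.
Qed.

Lemma sqnorm0 : sqnorm (fun=> 0%R) = 0%E.
Proof.
rewrite /sqnorm; under eq_integral do rewrite cabs0 expr0n.
by rewrite integral0.
Qed.

Lemma L2D f g : L2 f -> L2 g -> L2 (fun x => f x + g x).
Proof.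
move=> /L2P[mf fy] /L2P[mg gy]; apply/L2P; split; first exact: cmeasurableD.
by rewrite (le_lt_trans (sqnormD mf mg))// lte_add_pinfty// lte_mul_pinfty.
Qed.

Lemma L2Z z f : L2 f -> L2 (fun x => z * f x).
Proof.
move=> /L2P[mf fy]; apply/L2P; split.
  by apply: cmeasurableM => //; exact: cmeasurable_cst.
by rewrite sqnormZ// lte_mul_pinfty// lee_fin sqr_ge0.
Qed.

Lemma L20 : L2 (fun _ : 'rV[R]_n => 0 : R[i]).
Proof. by apply/L2P; split; [exact: cmeasurable_cst|rewrite sqnorm0 ltry]. Qed.

Lemma L2B f g : L2 f -> L2 g -> L2 (fun x => f x - g x).
Proof.
move=> f2 g2; rewrite (_ : (fun x => _) = (fun x => f x + (-1) * g x)).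
  by apply: L2D => //; exact: L2Z.
by apply/funext => x; rewrite mulN1r.
Qed.

Lemma L2_sum (I : Type) (s : seq I) (c : I -> R[i]) (e : I -> 'rV[R]_n -> R[i]) :
  (forall i, L2 (e i)) -> L2 (fun x => \sum_(i <- s) c i * e i x).
Proof.
move=> e2; elim: s => [|i s IH]; first by under eq_fun do rewrite big_nil; exact: L20.
by under eq_fun do rewrite big_cons; apply: L2D => //; exact: L2Z.
Qed.

Lemma innerDl f g h : L2 f -> L2 g -> L2 h ->
  inner (fun x => f x + g x) h = inner f h + inner g h.
Proof.
move=> f2 g2 h2; rewrite -cintegralD; [|exact: cintegrable_mulJ..].
by apply: eq_cintegral => x; rewrite mulrDl.
Qed.

Lemma innerZl z f h : L2 f -> L2 h ->
  inner (fun x => z * f x) h = z * inner f h.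
Proof.
move=> f2 h2; rewrite -cintegralZ; last exact: cintegrable_mulJ.
by apply: eq_cintegral => x; rewrite mulrA.
Qed.

Lemma innerJ f g : L2 f -> L2 g -> inner g f = (inner f g)^*.
Proof.
move=> f2 g2; rewrite -cintegralJ; last exact: cintegrable_mulJ.
by apply: eq_cintegral => x; rewrite conjM conjCK mulrC.
Qed.

Lemma inner0l h : L2 h -> inner (fun=> 0) h = 0.
Proof.
move=> h2; rewrite (_ : (fun=> 0) = (fun x : 'rV[R]_n => 0 * h x)).
  by rewrite innerZl// mul0r.
by apply/funext => x; rewrite mul0r.
Qed.

Lemma inner_suml (I : Type) (s : seq I) (c : I -> R[i])
    (e : I -> 'rV[R]_n -> R[i]) h :
  (forall i, L2 (e i)) -> L2 h ->
  inner (fun x => \sum_(i <- s) c i * e i x) h = \sum_(i <- s) c i * inner (e i) h.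
Proof.
move=> e2 h2; elim: s => [|i s IH].
  rewrite big_nil; apply: etrans (inner0l h2).
  by congr inner; apply/funext => x; rewrite big_nil.
rewrite big_cons -IH -innerZl// -innerDl//; [|exact: L2Z|exact: L2_sum].
by congr inner; apply/funext => x; rewrite big_cons.
Qed.

End complex_integral.

(** * Orthonormal systems and closed spans *)

Section finite_subsums.
Context {R : realType} {I : choiceType} (D : set I) (a : I -> R).

(** [esum] is a supremum over finite sets in the classical sense; this lemma and the next two trade
    these for [{fset I}], over which linear combinations are written. *)
Lemma esum_fset_le (M : \bar R) :
  (forall F : {fset I}, [set` F] `<=` D -> ((\sum_(i <- F) a i)%:E <= M)%E) ->
  (\esum_(i in D) (a i)%:E <= M)%E.
Proof.
move=> aM; apply: ge_ereal_sup => _ [A [/finite_fsetP[F ->] FD] <-].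
by rewrite fsbig_finite// set_fsetK sumEFin; exact: aM.
Qed.

Lemma esum_fset_ge (F : {fset I}) : [set` F] `<=` D ->
  ((\sum_(i <- F) a i)%:E <= \esum_(i in D) (a i)%:E)%E.
Proof.
move=> FD; apply: esum_ge; exists [set` F].
  by split => //; apply/finite_fsetP; exists F.
by rewrite fsbig_finite ?set_fsetK ?sumEFin.
Qed.

Lemma esum_fset_adherent (M e : R) : 0 < e ->
  (\esum_(i in D) (a i)%:E = M%:E)%E ->
  exists F : {fset I}, [set` F] `<=` D /\ M - e < \sum_(i <- F) a i.
Proof.
move=> e0 aM.
have fM : (\esum_(i in D) (a i)%:E)%E \is a fin_num by rewrite aM.
have [_ [A [/finite_fsetP[F ->] FD] <-]] := ub_ereal_sup_adherent e0 fM.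
rewrite -/(esum _ _) aM fsbig_finite ?set_fsetK ?sumEFin; last first.
  by apply/finite_fsetP; exists F.
by rewrite -EFinB lte_fin => aF; exists F.
Qed.

End finite_subsums.

Section orthonormal_expansion.
Context {R : realType} {n : nat} {I : choiceType}.
Variables (D : set I) (e : I -> 'rV[R]_n -> R[i]).
Implicit Types f g h : 'rV[R]_n -> R[i].

(** The condition that [dense_span] imposes on every [f] in [L2], isolated for a single function. *)
Definition in_closed_span f := forall eps : R, 0 < eps ->
  exists (F : {fset I}) (c : I -> R[i]), [set` F] `<=` D /\
    (L2norm (fun x => f x - \sum_(i <- F) c i * e i x)%R < eps%:E)%E.

Hypothesis e2 : forall i, L2 (e i).

Lemma innerBl f g h : L2 f -> L2 g -> L2 h ->
  inner (fun x => f x - g x) h = inner f h - inner g h.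
Proof.
move=> f2 g2 h2; rewrite -mulN1r -innerZl// -innerDl//; last exact: L2Z.
by congr inner; apply/funext => x; rewrite mulN1r.
Qed.

Lemma innerBB f g : L2 f -> L2 g ->
  inner (fun x => f x - g x) (fun x => f x - g x) =
  inner f f - inner f g - inner g f + inner g g.
Proof.
move=> f2 g2; have fg2 := L2B f2 g2.
rewrite innerBl// (innerJ fg2 f2) (innerJ fg2 g2) !innerBl//.
rewrite !conjB -!innerJ//; ring.
Qed.

Hypothesis one : orthonormal_system D e.

(** Orthonormality leaves only diagonal terms, and completing the square in the coefficients
    separates a part independent of [c] from one that vanishes when [c] consists of the Fourier
    coefficients. *)
Lemma inner_sub_sum (F : {fset I}) (c : I -> R[i]) f : [set` F] `<=` D -> L2 f ->
  let s x := \sum_(i <- F) c i * e i x in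
  inner (fun x => f x - s x) (fun x => f x - s x) =
  inner f f - \sum_(i <- F) inner f (e i) * (inner f (e i))^*
  + \sum_(i <- F) (c i - inner f (e i)) * (c i - inner f (e i))^*.
Proof.
move=> FD f2 s; have s2 : L2 s by exact: L2_sum.
have sf : inner s f = \sum_(i <- F) c i * (inner f (e i))^*.
  by rewrite inner_suml//; apply: eq_bigr => i _; rewrite -innerJ.
have fs : inner f s = \sum_(i <- F) (c i)^* * inner f (e i).
  rewrite innerJ// sf conj_sum; apply: eq_bigr => i _.
  by rewrite conjM conjCK.
have ss : inner s s = \sum_(i <- F) c i * (c i)^*.
  rewrite inner_suml//; apply: eq_big_seq => i iF.
  rewrite innerJ// inner_suml//; congr (_ * _^*).
  rewrite (bigD1_seq i)//= one.2 ?eqxx ?mulr1//; [|exact: FD..].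
  rewrite big_seq_cond big1 ?addr0// => j /andP[jF ji].
  by rewrite one.2 ?(negPf ji) ?mulr0//; exact: FD.
rewrite innerBB// sf fs ss -!addrA; congr (_ + _).
rewrite -!sumrN -!big_split /=; apply: eq_bigr => i _.
rewrite conjB; ring.
Qed.

Lemma sqnorm_sub_sum (F : {fset I}) (c : I -> R[i]) f : [set` F] `<=` D -> L2 f ->
  fine (sqnorm (fun x => f x - \sum_(i <- F) c i * e i x)) =
  fine (sqnorm f) - \sum_(i <- F) cabs (inner f (e i)) ^+ 2
  + \sum_(i <- F) cabs (c i - inner f (e i)) ^+ 2.
Proof.
move=> FD f2.
have s2 : L2 (fun x => \sum_(i <- F) c i * e i x) by exact: L2_sum.
have := inner_sub_sum c FD f2; cbv zeta; rewrite !sqnormE//; last first.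
  exact: (L2B f2 s2).
have sumJ (a : I -> R[i]) : \sum_(i <- F) a i * (a i)^* =
    (\sum_(i <- F) cabs (a i) ^+ 2)%:C%C.
  by rewrite rmorph_sum; apply: eq_bigr => i _; exact: mulcJ.
by rewrite !sumJ -rmorphB -rmorphD; exact: complexI.
Qed.

Lemma sqnorm_sub_proj (F : {fset I}) f : [set` F] `<=` D -> L2 f ->
  fine (sqnorm (fun x => f x - \sum_(i <- F) inner f (e i) * e i x)) =
  fine (sqnorm f) - \sum_(i <- F) cabs (inner f (e i)) ^+ 2.
Proof.
move=> FD f2; rewrite sqnorm_sub_sum// [X in _ + X]big1 ?addr0// => i _.
by rewrite subrr cabs0 expr0n.
Qed.

Lemma bessel f : L2 f ->
  (\esum_(i in D) (cabs (inner f (e i)) ^+ 2)%:E <= sqnorm f)%E.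
Proof.
move=> f2; apply: esum_fset_le => F FD; rewrite sqnorm_fineK// lee_fin.
rewrite -subr_ge0 -sqnorm_sub_proj//; apply: fine_ge0; exact: sqnorm_ge0.
Qed.

(** Over a finite [F] the squared distance is smallest for the Fourier coefficients, where it equals
    [sqnorm f] minus a partial sum. So it can be made arbitrarily small exactly when the partial
    sums come arbitrarily close to [sqnorm f]. *)
Lemma parseval f : L2 f -> in_closed_span f <->
  (\esum_(i in D) (cabs (inner f (e i)) ^+ 2)%:E = sqnorm f)%E.
Proof.
move=> f2; split=> [fK|fE eps eps0].
  apply/eqP; rewrite eq_le bessel// andTb; apply/lee_addgt0Pr => eps eps0.
  have seps0 : 0 < Num.sqrt eps by rewrite sqrtr_gt0.
  have [F [c [FD lt_eps]]] := fK _ seps0.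
  have fc2 := L2B f2 (L2_sum F c e2).
  rewrite L2norm_lt// sqr_sqrtr ?ltW// (sqnorm_fineK fc2) lte_fin in lt_eps.
  rewrite sqnorm_sub_sum// in lt_eps.
  rewrite sqnorm_fineK//; apply: le_trans (leeD (esum_fset_ge _ FD) (lexx _)).
  rewrite -EFinD lee_fin -lerBlDl; apply: le_trans (ltW lt_eps).
  by rewrite lerDl sumr_ge0// => i _; exact: sqr_ge0.
rewrite sqnorm_fineK// in fE.
have eps20 : 0 < eps ^+ 2 by rewrite exprn_gt0.
have [F [FD ltF]] := esum_fset_adherent eps20 fE.
exists F, (fun i => inner f (e i)); split=> //.
rewrite L2norm_lt// sqnorm_fineK; last exact: (L2B f2 (L2_sum _ _ e2)).
rewrite lte_fin sqnorm_sub_proj//; lra.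
Qed.

End orthonormal_expansion.

(** * Polynomials converging to a step function *)

Section power_threshold.
Context {R : realType}.
Implicit Types u y : R.

Lemma bernoulli_sub u N : 0 <= u <= 1 -> 1 - N%:R * u <= (1 - u) ^+ N.
Proof.
move=> /andP[u0 u1]; elim: N => [|N IH]; first by rewrite mul0r subr0 expr0.
rewrite exprS; apply: le_trans (ler_wpM2l _ IH); last by rewrite subr_ge0.
rewrite -natr1; have : 0 <= N%:R * u ^+ 2 by rewrite mulr_ge0// sqr_ge0.
by rewrite expr2; nra.
Qed.

Lemma bernoulli_add u N : 0 <= u -> 1 + N%:R * u <= (1 + u) ^+ N.
Proof.
move=> u0; elim: N => [|N IH]; first by rewrite mul0r addr0 expr0.
rewrite exprS; apply: le_trans (ler_wpM2l _ IH); last by rewrite addr_ge0.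
rewrite -natr1; have : 0 <= N%:R * u ^+ 2 by rewrite mulr_ge0// sqr_ge0.
by rewrite expr2; nra.
Qed.

(** The exponent [2 ^ n] is chosen so that [2 ^ n * y ^ n = (2 * y) ^ n], which tends to [0] below
    [1/2] and to infinity above it; Bernoulli's inequality turns this into the limits [1] and [0].
    At [y = 1/2] the limit would be [1/e]. *)
Lemma cvg_power_threshold y : 0 <= y <= 1 -> y != 2^-1 ->
  (1 - y ^+ n) ^+ (2 ^ n) @[n --> \oo] --> ((y < 2^-1)%R%:R : R).
Proof.
move=> /andP[y0 y1] yN.
have yn01 n : 0 <= y ^+ n <= 1 by rewrite exprn_ge0//= exprn_ile1.
have E n : (2 ^ n)%:R * y ^+ n = (2 * y) ^+ n by rewrite natrX exprMn.
have P01 n : 0 <= (1 - y ^+ n) ^+ (2 ^ n) <= 1.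
  have /andP[a b] := yn01 n.
  by rewrite exprn_ge0 ?subr_ge0//= exprn_ile1 ?subr_ge0// gerBl.
case: ltP => [ylt|yge].
  have c0 : (2 * y) ^+ n @[n --> \oo] --> 0.
    by apply: cvg_expr; rewrite ger0_norm ?mulr_ge0//; lra.
  apply: (@squeeze_cvgr _ _ _ _ (fun n => 1 - (2 * y) ^+ n) (cst 1)).
  - near=> n; have /andP[_ ->] := P01 n; rewrite andbT -E.
    exact: bernoulli_sub.
  - by rewrite -[X in _ --> X]subr0; apply: cvgB => //; exact: cvg_cst.
  - exact: cvg_cst.
have ygt : 2^-1 < y by rewrite lt_neqAle eq_sym yN.
have c0 : ((2 * y)^-1) ^+ n @[n --> \oo] --> 0.
  apply: cvg_expr; rewrite ger0_norm ?invr_ge0 ?mulr_ge0//.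
  by rewrite invf_lt1 ?mulr_gt0//; lra.
apply: (@squeeze_cvgr _ _ _ _ (cst 0) (fun n => ((2 * y)^-1) ^+ n)) => //.
- near=> n; have /andP[-> _] := P01 n; rewrite andTb.
  have /andP[a b] := yn01 n; have y2 : 0 < (2 * y) ^+ n.
    by rewrite exprn_gt0//; lra.
  rewrite exprVn -[leRHS]mul1r ler_pdivlMr//.
  (* The second factor is at least [(2 * y) ^ n] by Bernoulli, while the product is
     [(1 - y ^ (2 * n)) ^ (2 ^ n)], which is at most [1]. *)
  apply: (@le_trans _ _ ((1 - y ^+ n) ^+ (2 ^ n) * (1 + y ^+ n) ^+ (2 ^ n))).
    apply: ler_wpM2l; first by rewrite exprn_ge0// subr_ge0.
    by apply: le_trans (bernoulli_add _ a); rewrite E lerDr.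
  rewrite -exprMn exprn_ile1//; nra.
- exact: cvg_cst.
Unshelve. all: by end_near. Qed.

End power_threshold.

(** * Closed subspaces of [L2] *)

Section closed_subspaces.
Context {R : realType} {n : nat}.
Implicit Types f g : 'rV[R]_n -> R[i].

(** A predicate on representatives: its closedness clause, used at distance zero, also makes [K]
    insensitive to changes of a square integrable function on null sets. *)
Record closed_subspace (K : ('rV[R]_n -> R[i]) -> Prop) : Prop := ClosedSubspace {
  closed_subspace_L2 : forall f, K f -> L2 f ;
  closed_subspaceD : forall f g, K f -> K g -> K (fun x => f x + g x) ;
  closed_subspaceZ : forall z f, K f -> K (fun x => z * f x) ;
  closed_subspace_closed : forall f, L2 f ->
    (forall eps : R, 0 < eps ->
      exists2 g, K g & (sqnorm (fun x => (f x - g x)%R) < eps%:E)%E) -> K f }.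

Context {I : choiceType} (D : set I) (e : I -> 'rV[R]_n -> R[i]).
Hypothesis e2 : forall i, L2 (e i).

Lemma in_closed_spanP f : in_closed_span D e f <->
  forall eps : R, 0 < eps -> exists (F : {fset I}) (c : I -> R[i]),
    [set` F] `<=` D /\
    (sqnorm (fun x => (f x - \sum_(i <- F) c i * e i x)%R) < eps%:E)%E.
Proof.
split=> fK eps eps0.
  have seps0 : 0 < Num.sqrt eps by rewrite sqrtr_gt0.
  have [F [c [FD lt_eps]]] := fK _ seps0; exists F, c; split => //.
  by rewrite L2norm_lt// sqr_sqrtr ?ltW in lt_eps.
have [F [c [FD lt_eps]]] := fK _ (exprn_gt0 2 eps0); exists F, c; split => //.
by rewrite L2norm_lt.
Qed.

(** Padding coefficients by zero lets two combinations with different supports be added over the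
    union of the supports. *)
Lemma sum_fset_extend (F H : {fset I}) (c : I -> R[i]) x :
  {subset F <= H} ->
  \sum_(i <- H) (if i \in F then c i else 0) * e i x = \sum_(i <- F) c i * e i x.
Proof.
move=> FH; under eq_bigr => i _.
  rewrite (_ : _ * _ = if i \in F then c i * e i x else 0); last first.
    by case: ifP => // _; rewrite mul0r.
  over.
rewrite -big_mkcond -big_filter; apply: perm_big; apply: uniq_perm.
- by rewrite filter_uniq// fset_uniq.
- exact: fset_uniq.
- by move=> i; rewrite mem_filter andb_idr//; exact: FH.
Qed.

Lemma sqnormB_trans f g h : L2 f -> L2 g -> L2 h ->
  (sqnorm (fun x => (f x - h x)%R) <=
   2%:E * sqnorm (fun x => (f x - g x)%R) + 2%:E * sqnorm (fun x => (g x - h x)%R))%E.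
Proof.
move=> f2 g2 h2.
have := sqnormD (L2_cmeasurable (L2B f2 g2)) (L2_cmeasurable (L2B g2 h2)).
by under [X in sqnorm X]eq_fun do rewrite subrKA.
Qed.

Lemma closed_span_subspace : closed_subspace (fun f => L2 f /\ in_closed_span D e f).
Proof.
split=> [f [] //|f g [f2 fK] [g2 gK]|z f [f2 fK]|f f2 fK].
- split; first exact: L2D.
  (* A quarter each, because [sqnormD] doubles both errors. *)
  apply/in_closed_spanP => eps eps0; have eps4 : 0 < eps / 4 by rewrite divr_gt0.
  have /in_closed_spanP/(_ _ eps4)[F [c [FD ltF]]] := fK.
  have /in_closed_spanP/(_ _ eps4)[G [b [GD ltG]]] := gK.
  exists (F `|` G)%fset, (fun i => (if i \in F then c i else 0) +
    (if i \in G then b i else 0)); split.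
    by move=> i /=; rewrite inE => /orP[/FD|/GD].
  have Fc2 := L2B f2 (L2_sum F c e2); have Gb2 := L2B g2 (L2_sum G b e2).
  have := sqnormD (L2_cmeasurable Fc2) (L2_cmeasurable Gb2).
  rewrite (sqnorm_fineK Fc2) lte_fin in ltF.
  rewrite (sqnorm_fineK Gb2) lte_fin in ltG.
  rewrite (sqnorm_fineK Fc2) (sqnorm_fineK Gb2) => le_sum.
  apply: (@le_lt_trans _ _ (2 * fine (sqnorm (fun x => f x - \sum_(i <- F) c i * e i x))
    + 2 * fine (sqnorm (fun x => g x - \sum_(i <- G) b i * e i x)))%:E).
    rewrite EFinD !EFinM; apply: le_trans le_sum; rewrite le_eqVlt; apply/orP; left.
    apply/eqP; congr sqnorm; apply/funext => x.
    under eq_bigr do rewrite mulrDl.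
    rewrite big_split /= !sum_fset_extend; last 2 first.
      by move=> i iG; rewrite inE iG orbT.
      by move=> i iF; rewrite inE iF.
    by rewrite opprD addrACA.
  by rewrite lte_fin; lra.
- split; first exact: L2Z.
  apply/in_closed_spanP => eps eps0.
  (* The added [1] keeps the divisor positive when [z = 0]. *)
  pose M := cabs z ^+ 2 + 1; have M0 : 0 < M by rewrite ltr_wpDl// sqr_ge0.
  have /in_closed_spanP/(_ _ (divr_gt0 eps0 M0))[F [c [FD ltF]]] := fK.
  exists F, (fun i => z * c i); split=> //.
  have Fc2 := L2B f2 (L2_sum F c e2).
  rewrite (_ : (fun x => _) = (fun x => z * (f x - \sum_(i <- F) c i * e i x))).
    rewrite sqnormZ; last exact: L2_cmeasurable.
    rewrite (sqnorm_fineK Fc2) lte_fin ltr_pdivlMr// in ltF.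
    rewrite (sqnorm_fineK Fc2) -EFinM lte_fin; apply: le_lt_trans ltF.
    rewrite mulrC ler_wpM2l ?fine_ge0 ?sqnorm_ge0//.
    by rewrite lerDl.
  apply/funext => x; rewrite mulrBr mulr_sumr; congr (_ - _).
  by apply: eq_bigr => i _; rewrite mulrA.
- split=> //; apply/in_closed_spanP => eps eps0.
  have eps4 : 0 < eps / 4 by rewrite divr_gt0.
  have [g [g2 /in_closed_spanP/(_ _ eps4)[F [c [FD ltF]]]] ltg] := fK _ eps4.
  exists F, c; split=> //.
  have Fc2 := L2_sum F c e2.
  have := sqnormB_trans f2 g2 Fc2.
  rewrite (sqnorm_fineK (L2B f2 g2)) lte_fin in ltg.
  rewrite (sqnorm_fineK (L2B g2 Fc2)) lte_fin in ltF.
  rewrite (sqnorm_fineK (L2B f2 g2)) (sqnorm_fineK (L2B g2 Fc2)).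
  move=> /le_lt_trans; apply.
  by rewrite -!EFinM -EFinD lte_fin; lra.
Qed.

End closed_subspaces.

(** * Multipliers of a closed subspace *)

Section multipliers.
Context {R : realType} {n : nat}.
Implicit Types (f g : 'rV[R]_n -> R[i]) (m : 'rV[R]_n -> R).
Local Notation mu := (@lebesgue_rV R n).

Lemma cmeasurable_rmul m f : measurable_fun setT m -> cmeasurable f ->
  cmeasurable (fun x => (m x)%:C%C * f x).
Proof. by move=> mm mf; apply: cmeasurableM => //; split. Qed.

Lemma cabs_rmul (r : R) (z : R[i]) : cabs (r%:C%C * z) ^+ 2 = r ^+ 2 * cabs z ^+ 2.
Proof.
by rewrite cabsM exprMn; congr (_ * _); rewrite cabs_sqr /= expr0n addr0.
Qed.

Lemma L2_rmul m f (B : R) : measurable_fun setT m -> (forall x, `|m x| <= B) ->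
  L2 f -> L2 (fun x => (m x)%:C%C * f x).
Proof.
move=> mm mB f2; have mf := L2_cmeasurable f2.
apply/L2P; split; first exact: cmeasurable_rmul.
have Bf2 : L2 (fun x => B%:C%C * f x) by exact: L2Z.
have /L2P[_] := Bf2; apply: le_lt_trans; apply: le_sqnorm => [||x].
- exact: cmeasurable_rmul.
- exact: L2_cmeasurable.
- rewrite !cabs_rmul ler_wpM2r ?sqr_ge0// -ler_sqrt ?sqr_ge0// !sqrtr_sqr.
  by rewrite (le_trans (mB x))// ler_norm.
Qed.

Variable K : ('rV[R]_n -> R[i]) -> Prop.
Hypothesis KS : closed_subspace K.

(** Dominated convergence: [m] and all [m_ k] are bounded by [B], so the squared error is at most
    [4 * B ^ 2 * |f|^2], and the products with [m_ k] approach the product with [m] in norm. *)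
Lemma closed_subspace_dominated f (m_ : nat -> 'rV[R]_n -> R) m (B : R) :
  L2 f -> (forall k, measurable_fun setT (m_ k)) -> (forall k x, `|m_ k x| <= B) ->
  (forall x, m_ k x @[k --> \oo] --> m x) ->
  (forall k, K (fun x => (m_ k x)%:C%C * f x)) -> K (fun x => (m x)%:C%C * f x).
Proof.
move=> f2 mm_ mB m_m mK; have mf := L2_cmeasurable f2.
have mm : measurable_fun setT m.
  by apply: (measurable_fun_cvg mm_) => x _; exact: m_m.
have mB' x : `|m x| <= B.
  apply: (cvgr_to_le (cvg_norm (m_m x))).
  by apply: nearW => k; exact: mB.
have mf2 : L2 (fun x => (m x)%:C%C * f x) by exact: (L2_rmul mm mB').
apply: (closed_subspace_closed KS mf2) => eps eps0.
have E k x : cabs ((m x)%:C%C * f x - (m_ k x)%:C%C * f x) ^+ 2 =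
    (m x - m_ k x) ^+ 2 * cabs (f x) ^+ 2.
  by rewrite -mulrBl -rmorphB cabs_rmul.
have u0 : sqnorm (fun x => ((m x)%:C%C * f x - (m_ k x)%:C%C * f x)%R)
    @[k --> \oo] --> 0%E.
  rewrite [X in _ --> X](_ : _ = \int[mu]_x (0%R)%:E)%E; last by rewrite integral0.
  apply: (@dominated_cvg _ _ _ mu setT measurableT _ (fun=> 0%:E)
    (fun x => (4 * B ^+ 2 * cabs (f x) ^+ 2)%:E)) => //.
  - move=> k; apply/measurable_EFinP; under eq_fun do rewrite E.
    apply: measurable_funM; last exact: measurable_cabs_sqr.
    by apply: measurable_funX; exact: measurable_funB.
  - move=> x _; apply: cvg_EFin; first exact: nearW.
    rewrite (_ : _ \o _ = (fun k => (m x - m_ k x) ^+ 2 * cabs (f x) ^+ 2)).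
      have d0 : m x - m_ k x @[k --> \oo] --> 0.
        by rewrite -[X in _ --> X](subrr (m x)); apply: cvgB; [exact: cvg_cst|].
      have dc := cvgM (cvgM d0 d0) (@cvg_cst _ (cabs (f x) ^+ 2) _ \oo _).
      rewrite !mul0r in dc. exact: dc.
    by apply/funext => k /=; rewrite E.
  - exact: (integrableZl measurableT _ (L2_integrable_sqr f2)).
  - move=> k x _; rewrite lee_fin ger0_norm ?sqr_ge0// E ler_wpM2r ?sqr_ge0//.
    have := mB k x; have := mB' x; rewrite !ler_norml => /andP[? ?] /andP[? ?].
    nra.
have [k _ /(_ k (leqnn k)) lt_eps] :=
  u0 _ (nbhs_open_ereal_lt (f := fun=> eps) eps0).
by exists (fun x => (m_ k x)%:C%C * f x).
Qed.

Definition character (v x : 'rV[R]_n) : R[i] := expi (2 * pi * dot x v).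

Lemma cmeasurable_character v : cmeasurable (character v).
Proof.
by apply: cmeasurable_expi; apply: measurable_funM => //; exact: measurable_dot.
Qed.

Lemma cabs_character v x : cabs (character v x) = 1.
Proof. exact: cabs_expi. Qed.

Lemma characterD v w x : character (v + w) x = character v x * character w x.
Proof.
rewrite -expiD -mulrDr; congr (expi (_ * _)); rewrite /dot -big_split /=.
by apply: eq_bigr => i _; rewrite mxE mulrDr.
Qed.

Lemma L2_character v f : L2 f -> L2 (fun x => character v x * f x).
Proof.
move=> f2; have mf := L2_cmeasurable f2; apply/L2P; split.
  by apply: cmeasurableM => //; exact: cmeasurable_character.
have /L2P[_] := f2; apply: le_lt_trans; apply: le_sqnorm => // [|x].
  by apply: cmeasurableM => //; exact: cmeasurable_character.
by rewrite cabsM cabs_character mul1r.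
Qed.

(** The largest part of [K] that is invariant under all modulations; [K] itself need not be
    invariant. *)
Definition modulation_stable f := L2 f /\
  forall v, K (fun x => character v x * f x).

(** Multipliers act on the modulation-invariant part of [K], where characters act as well; this
    makes the trigonometric functions multipliers. Their values are real so that signs can be
    thresholded. *)
Definition multiplier m := [/\ measurable_fun setT m,
  exists B, forall x, `|m x| <= B &
  forall f, modulation_stable f -> modulation_stable (fun x => (m x)%:C%C * f x)].

Lemma eq_multiplier m m' : m =1 m' -> multiplier m -> multiplier m'.
Proof. by move=> mm'; rewrite (funext mm'). Qed.

Lemma modulation_stableD f g : modulation_stable f -> modulation_stable g ->
  modulation_stable (fun x => f x + g x).
Proof.
move=> [f2 fK] [g2 gK]; split; first exact: L2D.
move=> v; under eq_fun do rewrite mulrDr; exact: closed_subspaceD.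
Qed.

Lemma modulation_stableZ z f : modulation_stable f ->
  modulation_stable (fun x => z * f x).
Proof.
move=> [f2 fK]; split; first exact: L2Z.
by move=> v; under eq_fun do rewrite mulrCA; exact: closed_subspaceZ.
Qed.

Lemma modulation_stable_character v f : modulation_stable f ->
  modulation_stable (fun x => character v x * f x).
Proof.
move=> [f2 fK]; split; first exact: L2_character.
by move=> w; under eq_fun do rewrite mulrA -characterD; exact: fK.
Qed.

Lemma multiplier_cst r : multiplier (fun=> r).
Proof.
split; first exact: measurable_cst; first by exists `|r|.
by move=> f; exact: modulation_stableZ.
Qed.

Lemma multiplierD m m' : multiplier m -> multiplier m' ->
  multiplier (fun x => m x + m' x).
Proof.
move=> [mm [B mB] mK] [mm' [B' mB'] mK']; split; first exact: measurable_funD.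
  by exists (B + B') => x; rewrite (le_trans (ler_normD _ _))// lerD.
move=> f fA; rewrite (_ : (fun x => _) =
    (fun x => (m x)%:C%C * f x + (m' x)%:C%C * f x)).
  by apply: modulation_stableD; [exact: mK|exact: mK'].
by apply/funext => x; rewrite rmorphD mulrDl.
Qed.

Lemma multiplierM m m' : multiplier m -> multiplier m' ->
  multiplier (fun x => m x * m' x).
Proof.
move=> [mm [B mB] mK] [mm' [B' mB'] mK']; split; first exact: measurable_funM.
  exists (B * B') => x; rewrite normrM ler_pM//.
move=> f fA; rewrite (_ : (fun x => _) =
    (fun x => (m x)%:C%C * ((m' x)%:C%C * f x))).
  by apply: mK; exact: mK'.
by apply/funext => x; rewrite rmorphM mulrA.
Qed.

Lemma multiplierB m m' : multiplier m -> multiplier m' ->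
  multiplier (fun x => m x - m' x).
Proof.
move=> mm mm'; apply: (@eq_multiplier (fun x => m x + (-1) * m' x)).
  by move=> x; rewrite mulN1r.
by apply: multiplierD => //; apply: multiplierM => //; exact: multiplier_cst.
Qed.

Lemma multiplierX m k : multiplier m -> multiplier (fun x => m x ^+ k).
Proof.
move=> mm; elim: k => [|k IH]; first exact: multiplier_cst.
by under eq_fun do rewrite exprS; exact: multiplierM.
Qed.

Lemma multiplier_sum (I : Type) (s : seq I) (m_ : I -> 'rV[R]_n -> R) :
  (forall i, multiplier (m_ i)) -> multiplier (fun x => \sum_(i <- s) m_ i x).
Proof.
move=> mm; elim: s => [|i s IH].
  by under eq_fun do rewrite big_nil; exact: multiplier_cst.
by under eq_fun do rewrite big_cons; exact: multiplierD.
Qed.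

(** Multiplication by [m] commutes with modulation, so dominated convergence applies to each
    modulation of [f] separately. *)
Lemma multiplier_cvg (m_ : nat -> 'rV[R]_n -> R) m (B : R) :
  (forall k, multiplier (m_ k)) -> (forall k x, `|m_ k x| <= B) ->
  (forall x, m_ k x @[k --> \oo] --> m x) -> multiplier m.
Proof.
move=> mm_ mB m_m.
have mm_' k : measurable_fun setT (m_ k) by case: (mm_ k).
have mm : measurable_fun setT m.
  by apply: (measurable_fun_cvg mm_') => x _; exact: m_m.
have mB' x : `|m x| <= B.
  apply: (cvgr_to_le (cvg_norm (m_m x))).
  by apply: nearW => k; exact: mB.
split => //; first by exists B.
move=> f fA; have [f2 _] := fA.
split; first exact: (L2_rmul mm mB').
move=> v; under eq_fun do rewrite mulrCA.
apply: (@closed_subspace_dominated _ m_ m B) => //; first exact: L2_character.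
move=> k; under eq_fun do rewrite mulrCA.
by case: (mm_ k) => _ _ /(_ _ fA)[].
Qed.

Lemma multiplier_cos v : multiplier (fun x => cos (2 * pi * dot x v)).
Proof.
have mt : measurable_fun setT (fun x : 'rV[R]_n => cos (2 * pi * dot x v)).
  by have [] := cmeasurable_character v.
split=> //; first by exists 1 => x; exact: cos_max.
move=> f fA; rewrite (_ : (fun x => _) = (fun x => (2^-1)%:C%C *
    (character v x * f x + character (- v) x * f x))).
  apply: modulation_stableZ; apply: modulation_stableD;
    exact: modulation_stable_character.
apply/funext => x; rewrite -mulrDl mulrA; congr (_ * _).
rewrite /character (_ : dot x (- v) = - dot x v); last first.
  by rewrite /dot -sumrN; apply: eq_bigr => i _; rewrite mxE mulrN.
rewrite mulrN /expi cosN sinN; apply/eqP; rewrite eq_complex /=.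
by apply/andP; split; apply/eqP; field.
Qed.

Lemma multiplier_sin v : multiplier (fun x => sin (2 * pi * dot x v)).
Proof.
have mt : measurable_fun setT (fun x : 'rV[R]_n => sin (2 * pi * dot x v)).
  by have [] := cmeasurable_character v.
split=> //; first by exists 1 => x; exact: sin_max.
(* [Complex 0 (- 2^-1)] is [1 / (2i)], from Euler's formula for the sine. *)
move=> f fA; rewrite (_ : (fun x => _) = (fun x => (Complex 0 (- 2^-1)) *
    (character v x * f x + (-1) * (character (- v) x * f x)))).
  apply: modulation_stableZ; apply: modulation_stableD;
    [|apply: modulation_stableZ]; exact: modulation_stable_character.
apply/funext => x; rewrite mulN1r -mulrBl mulrA; congr (_ * _).
rewrite /character (_ : dot x (- v) = - dot x v); last first.
  by rewrite /dot -sumrN; apply: eq_bigr => i _; rewrite mxE mulrN.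
rewrite mulrN /expi cosN sinN; apply/eqP; rewrite eq_complex /=.
by apply/andP; split; apply/eqP; field.
Qed.

End multipliers.

(** Two nested generation arguments: the coordinate preimages generate the sigma-algebra of row
    vectors, and the open rays to the right generate that of the real line. *)
Lemma sigma_algebra_rV_halfspaces (R : realType) n (C : set (set 'rV[R]_n)) :
  sigma_algebra setT C ->
  (forall i a, C [set x | a < x ord0 i]) -> measurable `<=` C.
Proof.
move=> [C0 CC CU] Ch; apply: smallest_sub; first by split.
move=> A; rewrite /= -bigcup_seq => -[i _ [B mB <-]]; rewrite setTI.
move: B mB; apply: (@subset_trans _ ((@RGenOInfty.G R).-sigma.-measurable)).
  by move=> B; rewrite -RGenOInfty.measurableE.
apply: smallest_sub => [|_ [a ->]]; last first.
  rewrite /= (_ : _ @^-1` _ = [set x : 'rV[R]_n | a < x ord0 i]).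
    exact: Ch.
  by apply/seteqP; split=> x; rewrite /= in_itv/= andbT.
split; first by rewrite /= preimage_set0.
- by move=> B CB /=; rewrite setTD preimage_setC -setTD; exact: CC.
- by move=> F CF /=; rewrite preimage_bigcup; exact: CU.
Qed.

(** * From trigonometric functions to bounded measurable multipliers *)

Section indicator_multipliers.
Context {R : realType} {n : nat}.
Variable K : ('rV[R]_n -> R[i]) -> Prop.
Hypothesis KS : closed_subspace K.
Implicit Types (m : 'rV[R]_n -> R) (A B : set 'rV[R]_n).

(** The powers [(1 - m ^ 2) ^ k] are multipliers and converge boundedly to the indicator of the zero
    set. *)
Lemma multiplier_eq0 m : multiplier K m -> (forall x, `|m x| <= 1) ->
  multiplier K (fun x => (m x == 0)%R%:R).
Proof.
move=> mm m1; have m2 x : 0 <= m x ^+ 2 <= 1.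
  by rewrite sqr_ge0 -real_normK ?num_real// exprn_ile1 ?normr_ge0.
apply: (multiplier_cvg KS (m_ := fun k x => (1 - m x ^+ 2) ^+ k) (B := 1)).
- move=> k; apply: multiplierX => //; apply: multiplierB => //.
    exact: multiplier_cst.
  exact: multiplierX.
- move=> k x; have /andP[a b] := m2 x.
  by rewrite ger0_norm ?exprn_ge0 ?exprn_ile1 ?subr_ge0// gerBl.
- move=> x; have [->|mx0] := eqVneq (m x) 0.
    by rewrite expr0n subr0; under eq_cvg do rewrite expr1n; exact: cvg_cst.
  apply: cvg_expr; have /andP[a b] := m2 x.
  by rewrite ger0_norm ?subr_ge0// gtrBl exprn_even_gt0.
Qed.

(** The affine change [y = (1 - m) / 2] turns positivity of [m] into [y < 1/2], to which the
    threshold polynomials apply. *)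
Lemma multiplier_gt0 m : multiplier K m -> (forall x, `|m x| <= 1) ->
  multiplier K (fun x => (0 < m x)%R%:R).
Proof.
move=> mm m1; pose y x := 2^-1 * (1 - m x).
have y01 x : 0 <= y x <= 1.
  by have := m1 x; rewrite ler_norml /y => /andP[? ?]; apply/andP; split; lra.
have my : multiplier K y.
  apply: multiplierM => //; first exact: multiplier_cst.
  by apply: multiplierB => //; exact: multiplier_cst.
(* The correcting factor makes the power sequence converge where [m x = 0]. *)
apply: (multiplier_cvg KS (B := 1)
  (m_ := fun k x => (1 - y x ^+ k) ^+ (2 ^ k) * (1 - (m x == 0)%R%:R))).
- move=> k; apply: multiplierM => //.
    apply: multiplierX => //; apply: multiplierB => //; first exact: multiplier_cst.
    exact: multiplierX.
  by apply: multiplierB => //; [exact: multiplier_cst|exact: multiplier_eq0].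
- move=> k x; have /andP[a b] := y01 x.
  have yk : 0 <= 1 - y x ^+ k <= 1.
    by rewrite subr_ge0 exprn_ile1//= gerBl exprn_ge0.
  have /andP[c d] := yk.
  rewrite normrM ger0_norm ?exprn_ge0//.
  case: eqP => _; first by rewrite subrr normr0 mulr0.
  by rewrite subr0 normr1 mulr1 exprn_ile1.
- move=> x; have [mx0|mx0] := eqVneq (m x) 0.
    rewrite mx0 ltxx subrr; under eq_cvg do rewrite mulr0; exact: cvg_cst.
  rewrite subr0; under eq_cvg do rewrite mulr1.
  rewrite (_ : (0 < m x) = (y x < 2^-1)); last first.
    by rewrite /y; apply/idP/idP => ?; lra.
  apply: cvg_power_threshold => //.
  by apply: contra_neq mx0; rewrite /y => ?; lra.
Qed.

Lemma multiplier_setC A : multiplier K \1_A -> multiplier K \1_(~` A).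
Proof.
move=> mA; apply: (@eq_multiplier _ _ _ (fun x => 1 - \1_A x)).
  by move=> x; rewrite !indicE in_setC; case: (x \in A); rewrite ?subrr ?subr0.
by apply: multiplierB => //; exact: multiplier_cst.
Qed.

Lemma multiplier_setI A B : multiplier K \1_A -> multiplier K \1_B ->
  multiplier K \1_(A `&` B).
Proof.
move=> mA mB; apply: (@eq_multiplier _ _ _ (fun x => \1_A x * \1_B x)).
  by move=> x; rewrite !indicE in_setI -natrM mulnb.
exact: multiplierM.
Qed.

Lemma multiplier_setU A B : multiplier K \1_A -> multiplier K \1_B ->
  multiplier K \1_(A `|` B).
Proof.
move=> mA mB; rewrite -(setCK (A `|` B)) setCU; apply: multiplier_setC.
by apply: multiplier_setI; exact: multiplier_setC.
Qed.

Lemma multiplier_set0 : multiplier K \1_set0.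
Proof.
by apply: (@eq_multiplier _ _ _ (fun=> 0)) => [x|];
  [rewrite indic0|exact: multiplier_cst].
Qed.

Lemma cvg_indic_bigcup (T : Type) (F : (set T)^nat) x :
  (\1_(\bigcup_(i < k) F i) x : R) @[k --> \oo] --> (\1_(\bigcup_i F i) x : R).
Proof.
apply: cvg_near_cst; have [[i _ Fi]|nF] := pselect ((\bigcup_i F i) x).
  exists i.+1 => // k /= ik; rewrite !indicE !mem_set//; first by exists i.
  by exists i.
exists 0%N => // k _; rewrite /= !indicE !memNset//.
by move=> [i _ Fi]; apply: nF; exists i.
Qed.

Lemma norm_indic_le1 (T : Type) (A : set T) x : `|\1_A x : R| <= 1.
Proof. by rewrite indicE; case: (_ \in _); rewrite ?normr1// normr0. Qed.

Lemma multiplier_sigma_algebra :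
  sigma_algebra setT [set A : set 'rV[R]_n | multiplier K \1_A].
Proof.
split; first exact: multiplier_set0.
- by move=> A mA; rewrite setTD; exact: multiplier_setC.
- move=> F mF.
  apply: (multiplier_cvg KS (B := 1) (m_ := fun k => \1_(\bigcup_(i < k) F i))).
  + elim=> [|k IH]; first by rewrite bigcup_mkord big_ord0; exact: multiplier_set0.
    rewrite bigcup_mkord big_ord_recr /= -bigcup_mkord.
    by apply: multiplier_setU => //; exact: mF.
  + by move=> k x; exact: norm_indic_le1.
  + by move=> x; exact: cvg_indic_bigcup.
Qed.

(** Stretched sines detect the sign: once [|x_i - a| / (k + 1) < pi], the sine of
    [(x_i - a) / (k + 1)] is positive exactly when [a < x_i]. Hence the indicators [m k] are
    eventually constant at each point. *)
Lemma multiplier_halfspace i a :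
  multiplier K \1_[set x : 'rV[R]_n | a < x ord0 i].
Proof.
(* The frequency that makes the phase of the character equal to [x_i / (k + 1)]. *)
pose v k : 'rV[R]_n := \row_j (if j == i then (2 * pi * k.+1%:R)^-1 else 0).
have vE k x : 2 * pi * dot x (v k) = x ord0 i / k.+1%:R.
  rewrite /dot (bigD1 i)//= big1 => [|j ji]; last first.
    by rewrite mxE (negPf ji) mulr0.
  have p0 : (pi : R) != 0 by rewrite gt_eqF// pi_gt0.
  rewrite mxE eqxx addr0; move: (pi : R) p0 => p p0.
  by field; rewrite nat1r pnatr_eq0.
pose m k (x : 'rV[R]_n) := (0 < sin ((x ord0 i - a) / k.+1%:R))%R%:R : R.
apply: (multiplier_cvg KS (B := 1) (m_ := m)).
- move=> k; apply: multiplier_gt0; last by move=> x; exact: sin_max.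
  apply: (@eq_multiplier _ _ _ (fun x =>
    sin (2 * pi * dot x (v k)) * cos (a / k.+1%:R) -
    cos (2 * pi * dot x (v k)) * sin (a / k.+1%:R))).
    by move=> x; rewrite -sinB vE -mulrBl.
  apply: multiplierB => //; apply: multiplierM => //; try exact: multiplier_cst.
    exact: multiplier_sin.
  exact: multiplier_cos.
- by move=> k x; rewrite /m; case: (_ < _); rewrite ?normr1// normr0.
- move=> x; apply: cvg_near_cst; rewrite indicE /m.
  pose u := x ord0 i - a.
  have : \forall k \near \oo, `|u| / k.+1%:R < pi.
    near=> k; rewrite ltr_pdivrMr// -ltr_pdivrMl ?pi_gt0//.
    apply: (@lt_trans _ _ k%:R); last by rewrite ltr_nat.
    by near: k; exact: nbhs_infty_gtr.
  apply: filterS => k; rewrite -/u => uk; congr (nat_of_bool _)%:R.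
  have k0 : 0 < k.+1%:R :> R by [].
  apply/idP/idP => [|].
    apply: contraTT; rewrite notin_setE /= => /negP; rewrite -!leNgt => xa.
    rewrite -oppr_ge0 -sinN -mulNr.
    apply: sin_ge0_pi; rewrite divr_ge0/= ?oppr_ge0 ?subr_le0//.
    apply: ltW; apply: le_lt_trans uk; rewrite ler_wpM2r ?invr_ge0//.
    by rewrite -normrN ler_norm.
  move=> /set_mem /= xa; apply: sin_gt0_pi; rewrite divr_gt0 ?subr_gt0//=.
  by apply: le_lt_trans uk; rewrite ler_wpM2r ?invr_ge0// ler_norm.
Unshelve. all: by end_near. Qed.

Lemma multiplier_measurable A : measurable A -> multiplier K \1_A.
Proof.
apply: (sigma_algebra_rV_halfspaces multiplier_sigma_algebra).
exact: multiplier_halfspace.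
Qed.

Import HBNNSimple.

Lemma multiplier_nnsfun (g : {nnsfun 'rV[R]_n >-> R}) : multiplier K g.
Proof.
apply: (@eq_multiplier _ _ _
  (fun x => \sum_(y <- fset_set (range g)) y * \1_(g @^-1` [set y]) x)).
  by move=> x; rewrite -fsbig_finite ?fimfunE//; exact: fimfunP.
apply: multiplier_sum => // y; apply: multiplierM => //; first exact: multiplier_cst.
by apply: multiplier_measurable; exact: measurable_funPTI.
Qed.

(** Adding [B] makes [m] nonnegative; the increasing simple approximations of the sum are
    multipliers bounded by [2 * B]. *)
Lemma multiplier_bounded m (B : R) : measurable_fun setT m ->
  (forall x, `|m x| <= B) -> multiplier K m.
Proof.
move=> mm mB; pose h x := m x + B.
have h0 x : 0 <= h x by have := mB x; rewrite ler_norml /h => /andP[? _]; lra.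
have hB x : h x <= 2 * B by have := mB x; rewrite ler_norml /h => /andP[_ ?]; lra.
have mh : measurable_fun setT (EFin \o h).
  by apply/measurable_EFinP; exact: measurable_funD.
apply: (@eq_multiplier _ _ _ (fun x => h x - B)); first by move=> x; rewrite addrK.
apply: multiplierB => //; last exact: multiplier_cst.
pose s := nnsfun_approx measurableT mh.
have hE0 x : setT x -> (0 <= (EFin \o h) x)%E by move=> _; rewrite lee_fin.
apply: (multiplier_cvg KS (B := 2 * B) (m_ := s)) => [k|k x|x].
- exact: multiplier_nnsfun.
- rewrite ger0_norm ?fun_ge0// /s nnsfun_approxE; apply: le_trans (hB x).
  by rewrite -lee_fin; exact: (le_approx k hE0).
- have : (s k x)%:E @[k --> \oo] --> (h x)%:E.
    exact: (cvg_nnsfun_approx measurableT mh hE0 (x := x) I).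
  by move=> /fine_cvgP[].
Qed.

End indicator_multipliers.

(** * Closed subspaces containing all time-frequency shifts of a window *)

Section time_frequency_shifts.
Context {R : realType} {n : nat}.
Implicit Types f g : 'rV[R]_n -> R[i].

Lemma tfshiftE g (l : 'rV[R]_n * 'rV[R]_n) :
  tfshift g l = (fun x => character l.2 x * g (x - l.1)).
Proof. by apply/funext => x; rewrite mulrC. Qed.

Lemma sqnorm_shift f (a : 'rV[R]_n) : cmeasurable f ->
  sqnorm (fun x => f (x + a)) = sqnorm f.
Proof.
move=> mf.
rewrite /sqnorm (@ge0_integral_shift_rV _ _ a (fun x => (cabs (f x) ^+ 2)%:E))//.
  by apply/measurable_EFinP; exact: measurable_cabs_sqr.
by move=> x; rewrite lee_fin sqr_ge0.
Qed.

Lemma L2_shift f (a : 'rV[R]_n) : L2 f -> L2 (fun x => f (x + a)).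
Proof.
move=> /L2P[mf fy]; apply/L2P; split; first exact: cmeasurable_shift.
by rewrite sqnorm_shift.
Qed.

Lemma sqnorm_character f (v : 'rV[R]_n) :
  sqnorm (fun x => character v x * f x) = sqnorm f.
Proof.
by rewrite /sqnorm; apply: eq_integral => x _; rewrite cabsM cabs_character mul1r.
Qed.

Lemma L2_tfshift g l : L2 g -> L2 (tfshift g l).
Proof. by move=> g2; rewrite tfshiftE; exact/L2_character/L2_shift. Qed.

Lemma sqnorm_tfshift g l : L2 g -> sqnorm (tfshift g l) = sqnorm g.
Proof.
move=> g2; rewrite tfshiftE sqnorm_character sqnorm_shift//.
exact: L2_cmeasurable.
Qed.

End time_frequency_shifts.

(** * Restriction to the supports of translated windows *)

Section invariant_subspace.
Context {R : realType} {n : nat}.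
Local Notation mu := (@lebesgue_rV R n).
Variables (K : ('rV[R]_n -> R[i]) -> Prop) (g : 'rV[R]_n -> R[i]).
Hypotheses (KS : closed_subspace K) (g2 : L2 g).
Hypothesis gK : forall l, K (tfshift g l).
Implicit Types (f : 'rV[R]_n -> R[i]) (t : 'rV[R]_n) (A B : set 'rV[R]_n).

Lemma window_modulation_stable t : modulation_stable K (fun x => g (x - t)).
Proof.
split; first exact: L2_shift.
by move=> v; have := gK (t, v); rewrite tfshiftE.
Qed.

Lemma modulation_stable_mem f : modulation_stable K f -> K f.
Proof.
move=> [_ /(_ 0)]; congr K; apply/funext => x.
rewrite /character (_ : dot x 0 = 0) ?mulr0 ?expi0 ?mul1r//.
by rewrite /dot big1// => i _; rewrite mxE mulr0.
Qed.

Lemma real_bounded_mul_window (m : 'rV[R]_n -> R) (B : R) t :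
  measurable_fun setT m -> (forall x, `|m x| <= B) ->
  K (fun x => (m x)%:C%C * g (x - t)).
Proof.
move=> mm mB; apply: modulation_stable_mem.
by have [_ _] := multiplier_bounded KS mm mB; apply; exact: window_modulation_stable.
Qed.

Lemma bounded_mul_window (q : 'rV[R]_n -> R[i]) (B : R) t :
  cmeasurable q -> 0 <= B -> (forall x, cabs (q x) ^+ 2 <= B ^+ 2) ->
  K (fun x => q x * g (x - t)).
Proof.
move=> [mr mi] B0 qB.
rewrite (_ : (fun x => _) = (fun x => (complex.Re (q x))%:C%C * g (x - t) +
    (Complex 0 1) * ((complex.Im (q x))%:C%C * g (x - t)))); last first.
  apply/funext => x; rewrite mulrA -mulrDl; congr (_ * _).
  by case: (q x) => a b; apply/eqP; rewrite eq_complex /=; apply/andP; split;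
    apply/eqP; ring.
have normB (r s : R) : r ^+ 2 + s ^+ 2 <= B ^+ 2 -> `|r| <= B.
  move=> rsB; rewrite -(ger0_norm B0) -!sqrtr_sqr ler_sqrt ?sqr_ge0//.
  by apply: le_trans rsB; rewrite lerDl sqr_ge0.
apply: (closed_subspaceD KS); last apply: (closed_subspaceZ KS).
  apply: (real_bounded_mul_window (B := B)) => // x.
  by have := qB x; rewrite cabs_sqr; exact: normB.
apply: (real_bounded_mul_window (B := B)) => // x.
by have := qB x; rewrite cabs_sqr addrC; exact: normB.
Qed.

Definition restriction_stable B := measurable B /\
  forall f, L2 f -> K (fun x => (\1_B x : R)%:C%C * f x).

Definition window_support t := [set x | 0 < cabs (g (x - t)) ^+ 2].

Lemma measurable_superlevel (u : 'rV[R]_n -> R) (a : R) :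
  measurable_fun setT u -> measurable [set x | a < u x].
Proof.
move=> mu_; rewrite -[X in measurable X]setTI.
rewrite (_ : [set x | a < u x] = u @^-1` `]a, +oo[); first exact: mu_.
by apply/seteqP; split=> x; rewrite /= in_itv/= andbT.
Qed.

Lemma measurable_window_support t : measurable (window_support t).
Proof.
apply: measurable_superlevel; apply: measurable_cabs_sqr.
exact/cmeasurable_shift/L2_cmeasurable.
Qed.

Lemma measurable_inv_cabs_sqr f : cmeasurable f ->
  measurable_fun setT (fun x => (cabs (f x) ^+ 2)^-1).
Proof.
move=> mf.
(* Inversion is written as a real power, known to be measurable; both sides are [0] where [f]
   vanishes, since [0^-1 = 0]. *)
rewrite (_ : (fun x => _) = (@powR R ^~ (-1)) \o (fun x => cabs (f x) ^+ 2)).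
  apply: measurableT_comp; first exact: measurable_powR.
  exact: measurable_cabs_sqr.
by apply/funext => x; rewrite /= powRN powRr1// sqr_ge0.
Qed.

(** Where the translated window [h] does not vanish, [f] is the multiple [f * conj h / |h|^2] of
    [h]. This quotient is bounded on each set [E k], so the restriction of [f] to [E k] lies in [K];
    the indicators of the [E k] converge to that of the support. *)
Lemma restriction_stable_window t : restriction_stable (window_support t).
Proof.
split; first exact: measurable_window_support.
move=> f f2; pose h x := g (x - t).
have mf := L2_cmeasurable f2.
have mh : cmeasurable h by exact/cmeasurable_shift/L2_cmeasurable.
(* On [E k] the squared quotient [|f|^2 / |h|^2] is at most [k * k], the bound needed by
   [bounded_mul_window]. For [k = 0] the set is empty because of its first condition. *)
pose E k := [set x | cabs (f x) ^+ 2 < k%:R] `&` [set x | k%:R^-1 < cabs (h x) ^+ 2].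
have mE k : measurable (E k).
  apply: measurableI; last by apply: measurable_superlevel; exact: measurable_cabs_sqr.
  rewrite (_ : mkset _ = [set x | - k%:R < - cabs (f x) ^+ 2]).
    apply: measurable_superlevel; apply: measurable_funN.
    exact: measurable_cabs_sqr.
  by apply/seteqP; split=> x /=; rewrite ltrN2.
apply: (closed_subspace_dominated KS (m_ := fun k => \1_(E k)) (B := 1)) => //.
- by move=> k x; exact: norm_indic_le1.
- move=> x; have [hx|hx] := pselect (window_support t x); last first.
    apply: cvg_near_cst; apply: nearW => k; rewrite !indicE !memNset//.
    move=> [_ /= hk]; apply: hx; rewrite /window_support /=.
    by apply: le_lt_trans hk; rewrite invr_ge0.
  apply: cvg_near_cst; near=> k; rewrite !indicE !mem_set//; split=> /=.
    by near: k; exact: nbhs_infty_gtr.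
  rewrite invf_plt ?posrE//; first by near: k; exact: nbhs_infty_gtr.
  by near: k; exact: nbhs_infty_gtr.
move=> k; pose q x := ((\1_(E k) x : R) * (cabs (h x) ^+ 2)^-1)%:C%C *
  (f x * (h x)^*).
rewrite (_ : (fun x => _) = (fun x => q x * g (x - t))).
  apply: (bounded_mul_window (B := k%:R)) => // [|x].
    apply: cmeasurable_rmul; last exact: cmeasurableM (cmeasurableJ mh).
    apply: measurable_funM; first by apply: measurable_indic; exact: mE.
    exact: measurable_inv_cabs_sqr.
  rewrite /q cabs_rmul cabsM cabsJ indicE.
  have [/set_mem[/= fk hk]|_] := boolP (x \in E k); last first.
    by rewrite mul0r expr0n mul0r sqr_ge0.
  have k0 : 0 < k%:R :> R by apply: le_lt_trans fk; exact: sqr_ge0.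
  have h0 : 0 < cabs (h x) ^+ 2 by apply: lt_trans hk; rewrite invr_gt0.
  rewrite mul1r exprMn [X in X <= _](_ : _ =
      cabs (f x) ^+ 2 * (cabs (h x) ^+ 2)^-1); last first.
    by field; apply: contraTneq h0 => ->; rewrite expr0n ltxx.
  rewrite expr2; apply: ler_pM; rewrite ?sqr_ge0 ?invr_ge0 ?sqr_ge0//.
    exact: ltW.
  by rewrite invf_ple ?posrE// ltW.
apply/funext => x; rewrite /q -/(h x) indicE.
have [/set_mem[/= fk hk]|_] := boolP (x \in E k); last by rewrite !mul0r.
have h0 : 0 < cabs (h x) ^+ 2 by apply: le_lt_trans hk; rewrite invr_ge0.
rewrite !mul1r -mulrA -mulrA [_^* * _]mulrC mulcJ mulrCA -rmorphM mulVf ?gt_eqF//.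
by rewrite mulr1.
Unshelve. all: by end_near. Qed.

End invariant_subspace.

(** * Exhausting the mass of a function by stable restrictions *)

Section exhaustion.
Context {R : realType} {n : nat}.
Local Notation mu := (@lebesgue_rV R n).
Variables (K : ('rV[R]_n -> R[i]) -> Prop) (g : 'rV[R]_n -> R[i]).
Hypotheses (KS : closed_subspace K) (g2 : L2 g) (g0 : sqnorm g != 0%E).
Hypothesis gK : forall l, K (tfshift g l).
Implicit Types (f : 'rV[R]_n -> R[i]) (t : 'rV[R]_n) (A B : set 'rV[R]_n).

(** Restrict to [A] first, then restrict to [B] what remains off [A], which is again in [L2]. *)
Lemma restriction_stableU A B : restriction_stable K A -> restriction_stable K B ->
  restriction_stable K (A `|` B).
Proof.
move=> [mA KA] [mB KB]; split; first exact: measurableU.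
move=> f f2; pose h x := (\1_(~` A) x : R)%:C%C * f x.
have h2 : L2 h.
  apply: (@L2_rmul _ _ _ _ 1) => //; last by move=> x; exact: norm_indic_le1.
  by apply: measurable_indic; exact: measurableC.
rewrite (_ : (fun x => _) = (fun x => (\1_A x : R)%:C%C * f x +
    (\1_B x : R)%:C%C * h x)).
  by apply: (closed_subspaceD KS); [exact: KA|exact: KB].
apply/funext => x; rewrite /h mulrA -mulrDl -rmorphM -rmorphD; congr (_%:C%C * _).
rewrite !indicE in_setU in_setC.
by case: (x \in A); case: (x \in B); rewrite /= ?(mulr0, mulr1, addr0, add0r).
Qed.

Lemma restriction_stable_bigcup (F : (set 'rV[R]_n)^nat) :
  (forall k, restriction_stable K (F k)) -> restriction_stable K (\bigcup_k F k).
Proof.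
move=> FK.
(* The partial unions start with one set, so the base case is [F 0] and not the empty set. *)
have FK' k : restriction_stable K (\bigcup_(i < k.+1) F i).
  elim: k => [|k IH]; first by rewrite bigcup_mkord big_ord1.
  rewrite bigcup_mkord big_ord_recr /= -bigcup_mkord.
  exact: restriction_stableU.
split; first by apply: bigcup_measurable => k _; case: (FK k).
move=> f f2; apply: (closed_subspace_dominated KS
  (m_ := fun k => \1_(\bigcup_(i < k.+1) F i)) (B := 1)) => //.
- by move=> k; apply: measurable_indic; case: (FK' k).
- by move=> k x; exact: norm_indic_le1.
- move=> x; have := @cvg_indic_bigcup R _ F x.
  by rewrite -(cvg_shiftS (fun k => \1_(\bigcup_(i < k) F i) x : R)).
- by move=> k; case: (FK' k) => _; exact.
Qed.

Section mass.
Variable f : 'rV[R]_n -> R[i].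
Hypothesis f2 : L2 f.

(** The measure with density [|f|^2]; the indicator keeps all integrals over the whole space. *)
Definition mass B : \bar R := (\int[mu]_x (\1_B x * cabs (f x) ^+ 2)%:E)%E.

Let mphi : measurable_fun setT (fun x => cabs (f x) ^+ 2).
Proof. by apply: measurable_cabs_sqr; exact: L2_cmeasurable. Qed.

Let mE B : measurable B ->
  measurable_fun setT (fun x => (\1_B x * cabs (f x) ^+ 2)%:E).
Proof.
by move=> mB; apply/measurable_EFinP; apply: measurable_funM.
Qed.

Let E_ge0 B x : (0 <= (\1_B x * cabs (f x) ^+ 2)%:E)%E.
Proof. by rewrite lee_fin mulr_ge0// ?sqr_ge0// indicE. Qed.

Lemma mass_ge0 B : (0 <= mass B)%E.
Proof. by apply: integral_ge0 => x _; exact: E_ge0. Qed.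

Lemma le_mass A B : measurable A -> measurable B -> A `<=` B ->
  (mass A <= mass B)%E.
Proof.
move=> mA mB AB; apply: ge0_le_integral => //; [exact: mE|exact: mE|].
move=> x _; rewrite lee_fin ler_wpM2r ?sqr_ge0// !indicE.
by case: (boolP (x \in A)) => // /set_mem/AB/mem_set ->.
Qed.

Lemma massD A B : measurable A -> measurable B ->
  mass (A `|` B) = (mass A + mass (B `\` A))%E.
Proof.
move=> mA mB; rewrite /mass -ge0_integralD//; last 2 first.
- exact: mE.
- by apply: mE; exact: measurableD.
apply: eq_integral => x _; rewrite -EFinD -mulrDl; congr (_ * _)%:E.
rewrite !indicE in_setU in_setD.
by case: (x \in A); case: (x \in B); rewrite /= ?(addr0, add0r).
Qed.

Lemma mass_fin B : measurable B -> mass B \is a fin_num.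
Proof.
move=> mB; rewrite ge0_fin_numE ?mass_ge0//.
have /L2P[_] := f2; apply: le_lt_trans; apply: ge0_le_integral => //.
- exact: mE.
- by apply/measurable_EFinP; exact: mphi.
- by move=> x _; rewrite lee_fin ler_piMl ?sqr_ge0// indicE.
Qed.

(** The union of a maximizing sequence attains the supremum of the masses. Adjoining a window
    support keeps it stable and so cannot increase the mass, and finiteness of the mass allows
    cancellation. *)
Lemma maximal_restriction_stable : exists B, restriction_stable K B /\
  forall t, mass (window_support g t `\` B) = 0%E.
Proof.
pose S := [set mass B | B in restriction_stable K].
have S0 : S (mass (window_support g 0)).
  by exists (window_support g 0) => //; exact: restriction_stable_window.
have S_le : (ereal_sup S <= mass setT)%E.
  by apply: ge_ereal_sup => _ [B [mB _] <-]; exact: le_mass.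
have S_ge0 : (0 <= ereal_sup S)%E.
  by apply: le_trans (mass_ge0 _) (ereal_sup_ubound S0).
have S_fin : ereal_sup S \is a fin_num.
  rewrite ge0_fin_numE// (le_lt_trans S_le)// -ge0_fin_numE ?mass_ge0//.
  exact: mass_fin.
have /choice[F FP] : forall k, exists B, restriction_stable K B /\
    (ereal_sup S - (k.+1%:R^-1)%:E < mass B)%E.
  move=> k; have [|_ [B BK <-] ltB] := @ub_ereal_sup_adherent R S k.+1%:R^-1 _ S_fin.
    by rewrite invr_gt0.
  by exists B.
pose B := \bigcup_k F k.
have BK : restriction_stable K B.
  by apply: restriction_stable_bigcup => k; case: (FP k).
have mB := BK.1.
have S_B : (ereal_sup S <= mass B)%E.
  apply/lee_addgt0Pr => e e0.
  have [k _ ke] := near_infty_natSinv_lt (PosNum e0).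
  have [FK ltF] := FP k.
  rewrite -leeBlDr//; apply: (@le_trans _ _ (mass (F k))); last first.
    by apply: le_mass => //; [exact: FK.1|exact: bigcup_sup].
  apply: le_trans (ltW ltF); rewrite leeB// lee_fin ltW//.
  exact: (ke k (leqnn k)).
exists B; split=> // t.
have mt := measurable_window_support g2 t.
have BtK : restriction_stable K (B `|` window_support g t).
  by apply: restriction_stableU => //; exact: restriction_stable_window.
have : (mass (B `|` window_support g t) <= mass B)%E.
  by apply: le_trans S_B; apply: ereal_sup_ubound; exists (B `|` window_support g t).
rewrite massD// -[X in (_ <= X)%E]adde0 leeD2lE ?mass_fin// => le0.
by apply/eqP; rewrite eq_le le0 mass_ge0.
Qed.

Lemma window_support_neq0 : mu (window_support g 0) != 0%E.
Proof.
apply: contra g0 => /eqP mu0; apply/eqP.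
pose E := window_support g 0.
have mE0 : measurable E by exact: measurable_window_support.
have mg : measurable_fun setT (fun x => (cabs (g x) ^+ 2)%:E).
  apply/measurable_EFinP; apply: measurable_cabs_sqr.
  exact: L2_cmeasurable.
rewrite /sqnorm -(setUv E) ge0_integral_setU//.
- rewrite null_set_integral ?add0e//; last exact: measurable_funTS.
  apply: integral0_eq => x /=; rewrite /E /window_support /= subr0 => /negP.
  rewrite -leNgt => gx; congr EFin; apply/eqP; rewrite eq_le gx.
  exact: sqr_ge0.
- exact: measurableC.
- by rewrite setUv.
- by move=> x _; rewrite lee_fin sqr_ge0.
- by apply/disj_setPCl.
Qed.

(** The exceptional null sets depend on uncountably many [t], so they are averaged instead of
    united. Integrating [F] in [x] first gives zero for every [t]; integrating in [t] first gives
    [mu E] times the density of the mass off [B], by reflection invariance. As [mu E] is nonzero,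
    that mass is zero. *)
Lemma mass_complement B : measurable B ->
  (forall t, mass (window_support g t `\` B) = 0%E) -> mass (~` B) = 0%E.
Proof.
move=> mB mass0; pose E := window_support g 0.
have mE0 : measurable E by exact: measurable_window_support.
pose F (p : 'rV[R]_n * 'rV[R]_n) : \bar R :=
  ((\1_(~` B) p.1 * cabs (f p.1) ^+ 2) * \1_E (p.1 - p.2))%:E.
have msub : measurable_fun setT (fun p : 'rV[R]_n * 'rV[R]_n => p.1 - p.2).
  apply/measurable_fun_rVP => i; under eq_fun do rewrite !mxE.
  have mi := @measurable_coord_rV _ R n i.
  apply: measurable_funB.
    by apply: (measurableT_comp mi); exact: measurable_fst.
  by apply: (measurableT_comp mi); exact: measurable_snd.
have mreflect (x : 'rV[R]_n) : measurable_fun setT (fun t : 'rV[R]_n => x - t).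
  apply/measurable_fun_rVP => i; under eq_fun do rewrite !mxE.
  by apply: measurable_funB => //; exact: measurable_coord_rV.
have msubx x : measurable_fun setT (fun t => \1_E (x - t) : R).
  by apply: (measurableT_comp _ (mreflect x)); exact: measurable_indic.
have mF : measurable_fun setT F.
  apply/measurable_EFinP; apply: measurable_funM; last first.
    by apply: (measurableT_comp _ msub); exact: measurable_indic.
  have mBf : measurable_fun setT (fun x => \1_(~` B) x * cabs (f x) ^+ 2).
    by apply: measurable_funM => //; apply: measurable_indic; exact: measurableC.
  by apply: (measurableT_comp mBf); exact: measurable_fst.
have F0 p : (0 <= F p)%E.
  by rewrite lee_fin mulr_ge0// mulr_ge0// sqr_ge0.
have FE t : (\int[mu]_x F (x, t) = 0)%E.
  rewrite -(mass0 t) /mass; apply: eq_integral => x _.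
  rewrite /F /= mulrAC; congr (_ * _)%:E.
  rewrite !indicE in_setD in_setC mulrC -natrM mulnb; congr (nat_of_bool (_ && _))%:R.
  by apply/idP/idP => /set_mem /= h; apply/mem_set; move: h;
    rewrite /E /window_support /= subr0.
have := @fubini_tonelli _ _ _ _ _ mu mu F mF F0.
under [X in _ = X]eq_integral do rewrite FE.
rewrite integral0.
under eq_integral => x _.
  rewrite (_ : \int[mu]_t F (x, t) =
      mu E * (\1_(~` B) x * cabs (f x) ^+ 2)%:E)%E; last first.
    under eq_integral do rewrite /F /= EFinM.
    rewrite ge0_integralZl//; last by apply/measurable_EFinP; exact: msubx.
    rewrite muleC; congr (_ * _)%E.
    rewrite -(lebesgue_rV_reflect x mE0) -[X in _ = mu X]setIT -integral_indic//.
    by rewrite -[X in measurable X]setTI; exact: mreflect.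
  over.
rewrite ge0_integralZl//; last by apply: mE; exact: measurableC.
by move=> /eqP; rewrite mule_eq0 (negPf window_support_neq0)/= => /eqP.
Qed.

End mass.
End exhaustion.

Section exhaustion_conclusion.
Context {R : realType} {n : nat}.
Variables (K : ('rV[R]_n -> R[i]) -> Prop) (g : 'rV[R]_n -> R[i]).
Hypotheses (KS : closed_subspace K) (g2 : L2 g) (g0 : sqnorm g != 0%E).
Hypothesis gK : forall l, K (tfshift g l).

(** The restriction of [f] to [B] lies in [K] and is at distance zero from [f], so closedness
    finishes. *)
Lemma closed_subspace_tfshift_full f : L2 f -> K f.
Proof.
move=> f2; have [B [[mB BK] Bmass]] := maximal_restriction_stable KS g2 gK f2.
have mass0 := mass_complement g2 g0 f2 mB Bmass.
apply: (closed_subspace_closed KS f2) => eps eps0.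
exists (fun x => (\1_B x : R)%:C%C * f x); first exact: BK.
rewrite (_ : sqnorm _ = 0%E) ?lte_fin//.
rewrite -mass0 /sqnorm /mass; apply: eq_integral => x _; congr EFin.
rewrite -[X in X - _]mul1r -mulrBl -(rmorph1 (real_complex R)) -rmorphB cabs_rmul.
congr (_ * _); rewrite !indicE in_setC.
by case: (x \in B); rewrite /= ?subrr ?expr0n ?subr0 ?expr1n.
Qed.

End exhaustion_conclusion.

(** * Gabor systems *)

Section gabor_systems.
Context {R : realType} {n : nat}.
Local Notation shift := ('rV[R]_n * 'rV[R]_n)%type.
Implicit Types (f g : 'rV[R]_n -> R[i]) (a b w : shift).

Lemma dotDl (x y v : 'rV[R]_n) : dot (x + y) v = dot x v + dot y v.
Proof.
by rewrite /dot -big_split /=; apply: eq_bigr => i _; rewrite mxE mulrDl.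
Qed.

Lemma dotBr (x v w : 'rV[R]_n) : dot x (v - w) = dot x v - dot x w.
Proof.
by rewrite /dot -sumrB; apply: eq_bigr => i _; rewrite !mxE mulrBr.
Qed.

Lemma conj_expi (t : R) : (expi t)^* = expi (- t).
Proof. by rewrite expiN. Qed.

Lemma stftE g f a : stft g f a = inner f (tfshift g a).
Proof.
by apply: eq_cintegral => x; rewrite /tfshift conjM conj_expi mulrA.
Qed.

Lemma inner_tfshift f g a b : L2 f -> L2 g ->
  inner (tfshift f a) (tfshift g b) =
  expi (2 * pi * dot a.1 (a.2 - b.2)) * inner f (tfshift g (b - a)).
Proof.
move=> f2 g2; have gba2 : L2 (tfshift g (b - a)) by exact: L2_tfshift.
have fa2 : L2 (fun x => f (x - a.1)) by exact: L2_shift.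
have gbaa2 : L2 (fun x => tfshift g (b - a) (x - a.1)) by exact: L2_shift.
have mfg : cmeasurable (fun x => f x * (tfshift g (b - a) x)^*).
  by apply: cmeasurableM; [|apply: cmeasurableJ]; exact: L2_cmeasurable.
rewrite /inner -(cintegral_shift (- a.1) mfg) -cintegralZ; last first.
  exact: (cintegrable_mulJ fa2 gbaa2).
apply: eq_cintegral => x; rewrite /tfshift !conjM !conj_expi /=.
rewrite (_ : x - a.1 - (b.1 - a.1) = x - b.1); last first.
  by rewrite opprB addrA subrK.
rewrite (_ : - (2 * pi * dot (x - a.1) (b.2 - a.2)) =
    2 * pi * dot x a.2 + - (2 * pi * dot x b.2) -
    2 * pi * dot a.1 (a.2 - b.2)); last first.
  rewrite dotDl !dotBr (_ : dot (- a.1) _ = - dot a.1 b.2); last first.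
    by rewrite /dot -sumrN; apply: eq_bigr => i _; rewrite mxE mulNr.
  rewrite (_ : dot (- a.1) _ = - dot a.1 a.2); last first.
    by rewrite /dot -sumrN; apply: eq_bigr => i _; rewrite mxE mulNr.
  by move: (pi : R) => p; ring.
rewrite !expiD !expiN; set c := expi (2 * pi * dot a.1 _).
have cc : c * c^* = 1 by rewrite mulcJ cabs_expi expr1n.
(* Translating the integral on the right by [a.1] produced the phase [c^*]; it cancels against the
   unimodular prefactor [c]. *)
transitivity (f (x - a.1) * expi (2 * pi * dot x a.2) *
  ((g (x - b.1))^* * (expi (2 * pi * dot x b.2))^*) * (c * c^*)).
  by rewrite cc mulr1.
by ring.
Qed.

Lemma cabs_inner_tfshift f g a b : L2 f -> L2 g ->
  cabs (inner (tfshift f a) (tfshift g b)) = cabs (stft g f (b - a)).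
Proof.
by move=> f2 g2; rewrite inner_tfshift// cabsM cabs_expi mul1r stftE.
Qed.

Variable g : 'rV[R]_n -> R[i].
Hypotheses (g2 : L2 g) (g1 : sqnorm g = 1%E).

Lemma cabs_stft_sym a b : cabs (stft g g (b - a)) = cabs (stft g g (a - b)).
Proof.
rewrite -(cabs_inner_tfshift a b g2 g2) -(cabs_inner_tfshift b a g2 g2).
by rewrite innerJ ?cabsJ//; exact: L2_tfshift.
Qed.

Lemma inner_tfshift_self a : inner (tfshift g a) (tfshift g a) = 1.
Proof. by rewrite sqnormE ?sqnorm_tfshift ?g1//; exact: L2_tfshift. Qed.

Lemma cabs_stft0 a : cabs (stft g g (a - a)) = 1.
Proof.
by rewrite -(cabs_inner_tfshift a a g2 g2) inner_tfshift_self cabs1.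
Qed.

Context {I : choiceType} (D : set I) (s : I -> shift).

(** The index map [s] is kept general because both the identity and negation are needed, for the
    systems over [Lambda] and over [- Lambda]. *)
Lemma orthonormal_tfshiftP : orthonormal_system D (fun i => tfshift g (s i)) <->
  forall i j, D i -> D j -> i != j -> cabs (stft g g (s i - s j)) = 0.
Proof.
split=> [[_ one] i j Di Dj ij|ort].
  by rewrite -(cabs_inner_tfshift _ _ g2 g2) one// eq_sym (negPf ij) cabs0.
split=> [i _|i j Di Dj]; first exact: L2_tfshift.
have [<-|ij] := eqVneq i j; first by rewrite inner_tfshift_self.
apply: cabs_eq0; rewrite (cabs_inner_tfshift _ _ g2 g2) (cabs_stft_sym (s i)).
exact: ort.
Qed.

Lemma packing_orthonormal :
  (forall w, (\esum_(i in D) (cabs (stft g g (w - s i)) ^+ 2)%:E <= 1)%E) ->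
  orthonormal_system D (fun i => tfshift g (s i)).
Proof.
move=> pack; apply/orthonormal_tfshiftP => i j Di Dj ij.
have ijD : [set` [fset i; j]%fset] `<=` D.
  by move=> k /=; rewrite !inE => /orP[/eqP->|/eqP->].
have [a aE] : exists a : I -> R, forall k, a k = cabs (stft g g (s i - s k)) ^+ 2.
  by exists (fun k => cabs (stft g g (s i - s k)) ^+ 2).
(* The packing condition at [w = s i], cut down to two indices; the term of [i] alone is [1]. *)
have : ((\sum_(k <- [fset i; j]%fset) a k)%:E <= 1)%E.
  apply: le_trans (esum_fset_ge a ijD) _; rewrite (eq_esum (b :=
    fun k => (cabs (stft g g (s i - s k)) ^+ 2)%:E)) ?pack// => k _; by rewrite aE.
have ai : a i = 1 by rewrite aE (cabs_stft0 (s i)) expr1n.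
rewrite big_fsetU1 ?inE//= big_seq_fset1 ai lee_fin gerDl => aj.
by apply/eqP; rewrite -sqrf_eq0 -aE eq_le aj aE sqr_ge0.
Qed.

(** Since [|V_g g|] is even, the tiling identity at [l] is Parseval's identity for [tfshift g l]. So
    the closed span contains all shifts of [g], and such a closed subspace is everything. *)
Lemma tiling_dense : orthonormal_system D (fun i => tfshift g (s i)) ->
  (forall w, (\esum_(i in D) (cabs (stft g g (w - s i)) ^+ 2)%:E = 1)%E) ->
  dense_span D (fun i => tfshift g (s i)).
Proof.
move=> one tile.
have e2 i : L2 (tfshift g (s i)) by exact: L2_tfshift.
have KS := closed_span_subspace D e2.
suff gK l : L2 (tfshift g l) /\
    in_closed_span D (fun i => tfshift g (s i)) (tfshift g l).
  move=> f f2; have g0 : sqnorm g != 0%E by rewrite g1.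
  by have [] := closed_subspace_tfshift_full KS g2 g0 gK f2.
have gl2 : L2 (tfshift g l) by exact: L2_tfshift.
split=> //; apply/(parseval e2 one gl2).
rewrite sqnorm_tfshift// g1 -[RHS](tile l); apply: eq_esum => i _.
by rewrite (cabs_inner_tfshift l (s i) g2 g2) (cabs_stft_sym l (s i)).
Qed.

End gabor_systems.

Theorem theorem3p1 (R : realType) (d : nat) (g : 'rV[R]_d -> R[i])
    (Lambda : set ('rV[R]_d * 'rV[R]_d))
    (gL2 : L2 g) (g1 : L2norm g = 1%E)
    (Lambda_discrete : isolated Lambda = Lambda)
    (Lambda_countable : countable Lambda) :
  [<-> orthonormal_system Lambda (tfshift g);
       forall f : 'rV[R]_d -> R[i], L2 f -> L2norm f = 1%E ->
         forall w : 'rV[R]_d * 'rV[R]_d,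
         (\esum_(l in Lambda) (cabs (stft g f (w - l)) ^+ 2)%R%:E <= 1)%E;
       forall w : 'rV[R]_d * 'rV[R]_d,
         (\esum_(l in Lambda) (cabs (stft g g (w - l)) ^+ 2)%R%:E <= 1)%E]
  /\
  [<-> orthonormal_basis Lambda (tfshift g);
       forall f : 'rV[R]_d -> R[i], L2 f -> L2norm f = 1%E ->
         forall w : 'rV[R]_d * 'rV[R]_d,
         (\esum_(l in Lambda) (cabs (stft g f (w - l)) ^+ 2)%R%:E = 1)%E;
       forall w : 'rV[R]_d * 'rV[R]_d,
         (\esum_(l in Lambda) (cabs (stft g g (w - l)) ^+ 2)%R%:E = 1)%E].
Proof.
have g1' : sqnorm g = 1%E by apply/L2norm_eq1.
(* The terms [|V_g f (w - l)|] are coefficients of [tfshift f (- w)] in the system over [- Lambda],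
   hence this second system. *)
pose e l := tfshift g (- l).
have e2 l : L2 (e l) by exact: L2_tfshift.
have tf2 l : L2 (tfshift g l) by exact: L2_tfshift.
have oppE (a b : 'rV[R]_d * 'rV[R]_d) : - a - - b = b - a.
  by rewrite opprK addrC.
(* Passing to [- Lambda] only changes the sign of the differences, which evenness of [|V_g g|]
   absorbs. *)
have one : orthonormal_system Lambda (tfshift g) -> orthonormal_system Lambda e.
  move=> /(@orthonormal_tfshiftP _ _ _ gL2 g1' _ Lambda id) ort.
  apply/(@orthonormal_tfshiftP _ _ _ gL2 g1' _ Lambda (fun l => - l)).
  by move=> i j Di Dj ij; rewrite oppE (cabs_stft_sym gL2 i j); exact: ort.
have stft_inner f l w : L2 f ->
    cabs (stft g f (w - l)) = cabs (inner (tfshift f (- w)) (e l)).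
  by move=> f2; rewrite (cabs_inner_tfshift (- w) (- l) f2 gL2) opprK addrC.
split; tfae.
- move=> ort f f2 /L2norm_eq1 f1 w; rewrite -f1 -(sqnorm_tfshift (- w) f2).
  have := bessel e2 (one ort) (L2_tfshift (- w) f2).
  apply: le_trans; rewrite le_eqVlt; apply/orP; left; apply/eqP.
  by apply: eq_esum => l _; rewrite stft_inner.
- by move=> pack w; exact: pack.
- exact: (@packing_orthonormal _ _ _ gL2 g1' _ Lambda id).
- move=> [ort dense] f f2 /L2norm_eq1 f1 w.
  (* Completeness over [Lambda] gives Parseval's identity for [tfshift g (- w')], which reads as the
     tiling condition over [- Lambda]; [tiling_dense] then yields completeness of [e]. *)
  have tile w' : (\esum_(l in Lambda) (cabs (stft g g (w' - - l)) ^+ 2)%:E = 1)%E.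
    have /(parseval tf2 ort (tf2 (- w'))) := dense _ (tf2 (- w')).
    rewrite sqnorm_tfshift// g1' => <-; apply: eq_esum => l _.
    by rewrite (cabs_inner_tfshift (- w') l gL2 gL2) !opprK addrC.
  have edense : dense_span Lambda e.
    exact: (@tiling_dense _ _ _ gL2 g1' _ Lambda (fun l => - l) (one ort) tile).
  have fw2 := L2_tfshift (- w) f2.
  rewrite -f1 -(sqnorm_tfshift (- w) f2).
  rewrite -((parseval e2 (one ort) fw2).1 (edense _ fw2)).
  by apply: eq_esum => l _; rewrite stft_inner.
- by move=> tile w; exact: tile.
(* A tiling is in particular a packing, which gives orthonormality. *)
- move=> tile; have ort : orthonormal_system Lambda (tfshift g).
    apply: (@packing_orthonormal _ _ _ gL2 g1' _ Lambda id) => w.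
    by rewrite tile.
  split=> //; exact: (@tiling_dense _ _ _ gL2 g1' _ Lambda id ort tile).
Qed.
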